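(* Fix an integer $k\ge 2$, let $N=\binom{n}{k-1}$, and write the bias as $b=\frac{\beta N}{\log n}$. Then for every fixed $\varepsilon>0$ and all sufficiently large $n$: Maker wins the Berge Hamiltonicity Game on $H_{n,k}$ with bias $b$ if $\beta\le 1-\varepsilon$, and Breaker wins it if $\beta\ge 1+\varepsilon$.
   Context: $H_{n,k}$ is the complete $k$-uniform hypergraph on $n$ vertices. In a Maker-Breaker game with bias $b$ (a positive integer) on $H_{n,k}$, two players alternately claim previously unclaimed edges: in each round Maker first claims one edge and then Breaker claims $b$ edges (or all remaining edges, if fewer than $b$ remain). Play continues until all edges are claimed. Maker wins if the hypergraph formed by the edges she has claimed has the desired property; otherwise Breaker wins. ''A player wins'' means that this player has a winning strategy. In the Berge Hamiltonicity Game the desired property is that Maker's hypergraph contains a Berge Hamilton cycle, i.e. a sequence $(v_1,e_1,v_2,e_2,\dots,v_n,e_n)$ of distinct vertices $v_1,\dots,v_n$ comprising the whole vertex set and distinct edges $e_1,\dots,e_n$ with $\{v_i,v_{i+1}\}\subseteq e_i$ for $i=1,\dots,n$ (indices modulo $n$, so $v_{n+1}=v_1$). Here $\log$ is the natural logarithm. *)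

(* Defs.v *)
From mathcomp Require Import all_boot.

Set Implicit Arguments.
Unset Strict Implicit.
Unset Printing Implicit Defensive.

Section MakerBreaker.
Variables (T : finType) (X : {set T}) (b : nat).

(* The completed rounds, oldest first; (x, B) is the round in which Maker
   claimed x and Breaker then claimed the elements of B. *)
Definition history := seq (T * {set T}).

Definition maker_set (h : history) : {set T} := [set r.1 | r in h].
Definition breaker_set (h : history) : {set T} := \bigcup_(r <- h) r.2.
Definition unclaimed (h : history) : {set T} :=
  X :\: (maker_set h :|: breaker_set h).

Definition legal_maker_move (h : history) (x : T) : bool := x \in unclaimed h.

Definition legal_breaker_move (h : history) (x : T) (B : {set T}) : bool :=
  (B \subset unclaimed h :\ x) && (#|B| == minn b #|unclaimed h :\ x|).

(* Histories of legal play in which every round moreover satisfies C; below, C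
   says that one of the players follows a given strategy. *)
Inductive play (C : history -> T -> {set T} -> Prop) : history -> Prop :=
| play_nil : play C [::]
| play_rcons h x B :
    play C h -> legal_maker_move h x -> legal_breaker_move h x B ->
    C h x B -> play C (rcons h (x, B)).

Definition maker_strategy := history -> T.
Definition breaker_strategy := history -> T -> {set T}.

(* A winning strategy must prescribe a legal move whenever its owner has to
   move, whatever the opponent does, so every play it governs runs until the
   board is exhausted. *)
Definition maker_winning (W : {set T} -> Prop) (s : maker_strategy) : Prop :=
  forall h, play (fun h' x _ => x = s h') h ->
    (unclaimed h <> set0 -> legal_maker_move h (s h)) /\
    (unclaimed h = set0 -> W (maker_set h)).

Definition breaker_winning (W : {set T} -> Prop) (t : breaker_strategy) : Prop :=
  forall h, play (fun h' x B => B = t h' x) h ->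
    (forall x, legal_maker_move h x -> legal_breaker_move h x (t h x)) /\
    (unclaimed h = set0 -> ~ W (maker_set h)).

Definition maker_wins (W : {set T} -> Prop) : Prop :=
  exists s, maker_winning W s.
Definition breaker_wins (W : {set T} -> Prop) : Prop :=
  exists t, breaker_winning W t.

End MakerBreaker.

Definition complete_hypergraph (n k : nat) : {set {set 'I_n}} :=
  [set e : {set 'I_n} | #|e| == k].

(* ordS is the cyclic successor i |-> i + 1 mod n. *)
Definition has_berge_hamilton_cycle (n : nat) (H : {set {set 'I_n}}) : Prop :=
  exists (v : 'I_n -> 'I_n) (e : 'I_n -> {set 'I_n}),
    [/\ bijective v, injective e &
        forall i, e i \in H /\ [set v i; v (ordS i)] \subset e i].

Definition maker_wins_berge (n k b : nat) : Prop :=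
  maker_wins (complete_hypergraph n k) b (@has_berge_hamilton_cycle n).

Definition breaker_wins_berge (n k b : nat) : Prop :=
  breaker_wins (complete_hypergraph n k) b (@has_berge_hamilton_cycle n).

(* Main.v *)
(** Breaker first claims every edge meeting a fixed set of about n / (8 k^2 log n)
vertices at least twice. At least half of these vertices stay untouched, and their
unclaimed edges now form disjoint boxes, of which Maker destroys at most one per
round. To empty one of a boxes of size s by levelling them, Breaker needs only
about s / (1 + 1/2 + ... + 1/a) claims per round, so he isolates a vertex.

Maker assigns to each edge she claims a pair of its vertices. A Hamilton cycle in
the graph of these pairs is a Berge Hamilton cycle, because distinct pairs come
from distinct hyperedges. She first lets each vertex choose 5 pairs, always
serving the vertex with the largest danger (claimed degree minus a multiple of the
number of choices made). Averaging the danger over sets of vertices, in the manner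
of Gebauer and Szabo, shows that every unserved vertex keeps a positive proportion
of its edges unclaimed. Random choices would then give an expander;
derandomising by conditional expectations makes this a deterministic strategy.
By Posa's rotations an expander has quadratically many boosters, i.e. pairs whose
addition gives a Hamilton cycle or a longer longest path. There are more of them
than Breaker can have blocked, so Maker adds one in each of the next rounds. *)

Require Import Defs.
From mathcomp Require Import all_boot all_order all_algebra.
From mathcomp Require Import all_classical all_reals all_analysis.
From mathcomp Require Import ring lra zify.
(* Imported again because [classical_sets] shadows [set0], [subset_trans], etc. *)
From mathcomp Require Import fintype finset.
Set Implicit Arguments.
Unset Strict Implicit.
Unset Printing Implicit Defensive.

(** * Positional games *)

Lemma exists_card_between (T : finType) (A B : {set T}) m :
  A \subset B -> #|A| <= m <= #|B| ->
  exists C : {set T}, [/\ A \subset C, C \subset B & #|C| = m].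
Proof.
move=> AB /andP [Am]; elim: m Am => [|m IH].
  by rewrite leqn0 => /eqP A0 _; exists A; split.
rewrite leq_eqVlt => /orP [/eqP Am _|Am mB]; first by exists A.
have [C [AC CB cC]] := IH Am (ltnW mB).
have /subsetPn [y yB yC] : ~~ (B \subset C).
  by apply/negP => /subset_leq_card; rewrite cC leqNgt mB.
exists (y |: C); rewrite cardsU1 yC cC.
by split; rewrite ?(subset_trans AC) ?subsetUr // subUset sub1set yB.
Qed.

Lemma exists_subset_card (T : finType) (A : {set T}) m : m <= #|A| ->
  exists2 B : {set T}, B \subset A & #|B| = m.
Proof.
move=> mA; have [|B [_ BA cB]] := @exists_card_between _ set0 A m (sub0set A).
  by rewrite cards0.
by exists B.
Qed.

Section Positions.
Variables (T : finType) (X : {set T}) (b : nat).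
Implicit Types (h : history T) (M U B : {set T}) (x : T).

Lemma maker_set_rcons h x B : maker_set (rcons h (x, B)) = x |: maker_set h.
Proof.
apply/setP=> y; rewrite !inE; apply/imsetP/idP => [[[z Z]]|].
  rewrite mem_rcons inE => /orP [/eqP [-> _] -> /=|hz ->]; first by rewrite eqxx.
  by rewrite (imset_f (fun r => r.1) hz) orbT.
case/orP => [/eqP ->|/imsetP [r hr ->]].
  by exists (x, B) => //; rewrite mem_rcons inE eqxx.
by exists r => //; rewrite mem_rcons inE hr orbT.
Qed.

Lemma breaker_set_rcons h x B :
  breaker_set (rcons h (x, B)) = breaker_set h :|: B.
Proof. by rewrite /breaker_set -cats1 big_cat big_seq1. Qed.

Lemma unclaimed_rcons h x B :
  unclaimed X (rcons h (x, B)) = (unclaimed X h :\ x) :\: B.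
Proof.
apply/setP=> y; rewrite /unclaimed maker_set_rcons breaker_set_rcons !inE.
by case: (y == x); case: (y \in B); case: (y \in X); case: (y \in maker_set h);
  case: (y \in breaker_set h).
Qed.

Lemma unclaimed_nil : unclaimed X [::] = X.
Proof.
apply/setP=> y; rewrite /unclaimed /breaker_set big_nil !inE.
by case: imsetP => //= -[].
Qed.

Lemma maker_set_nil : maker_set ([::] : history T) = set0.
Proof. by apply/setP=> y; rewrite inE; case: imsetP => // -[]. Qed.

(** Choice turns a good reply in every position into a strategy on histories, so what follows sees
    only Maker's set and the free set. [x0] is the answer where [J] fails or the board is
    exhausted. *)
Lemma maker_wins_invariant (x0 : T) (W : {set T} -> Prop)
    (J : {set T} -> {set T} -> Prop) :
  J set0 X ->
  (forall M U, J M U -> U != set0 ->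
     exists2 x, x \in U & forall B, B \subset U :\ x -> #|B| <= b ->
       J (x |: M) ((U :\ x) :\: B)) ->
  (forall M, J M set0 -> W M) ->
  maker_wins X b W.
Proof.
move=> J0 Jstep Jend.
have /choice [s hs] : forall h, exists x,
    J (maker_set h) (unclaimed X h) -> unclaimed X h != set0 ->
    x \in unclaimed X h /\
    forall B, B \subset unclaimed X h :\ x -> #|B| <= b ->
      J (x |: maker_set h) ((unclaimed X h :\ x) :\: B).
  move=> h.
  case: (pselect (J (maker_set h) (unclaimed X h) /\ unclaimed X h != set0))
    => [[Jh Uh]|nJ].
    by have [x xU xB] := Jstep _ _ Jh Uh; exists x.
  by exists x0 => Jh Uh; case: nJ.
exists s.
have Jplay h : play X b (fun h' x _ => x = s h') h ->
    J (maker_set h) (unclaimed X h).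
  elim=> [|h' x B _ Jh lx /andP [sB /eqP cB] xs].
    by rewrite maker_set_nil unclaimed_nil.
  rewrite maker_set_rcons unclaimed_rcons.
  have Uh : unclaimed X h' != set0 by apply/set0Pn; exists x.
  have [_] := hs _ Jh Uh; rewrite -xs; apply => //.
  by rewrite cB geq_minl.
move=> h /Jplay Jh; split => [/eqP Uh|Uh]; first by have [] := hs _ Jh Uh.
by apply: Jend; rewrite -Uh.
Qed.

(** The rules fix the number of edges Breaker claims, while a plan may call for fewer. The step must
    therefore survive every enlargement [B] of the edges [B0] that matter. *)
Lemma breaker_wins_invariant (W : {set T} -> Prop)
    (J : {set T} -> {set T} -> Prop) :
  J set0 X ->
  (forall M U x, J M U -> x \in U ->
     exists B0, [/\ B0 \subset U :\ x, #|B0| <= b &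
       forall B, B0 \subset B -> B \subset U :\ x ->
         J (x |: M) ((U :\ x) :\: B)]) ->
  (forall M, J M set0 -> ~ W M) ->
  breaker_wins X b W.
Proof.
move=> J0 Jstep Jend.
have /choice [t ht] : forall hx : history T * T, exists B : {set T},
    J (maker_set hx.1) (unclaimed X hx.1) -> hx.2 \in unclaimed X hx.1 ->
    legal_breaker_move X b hx.1 hx.2 B /\
    J (hx.2 |: maker_set hx.1) ((unclaimed X hx.1 :\ hx.2) :\: B).
  move=> [h x] /=; set U := unclaimed X h.
  case: (pselect (J (maker_set h) U /\ x \in U)) => [[Jh xU]|nJ]; last first.
    by exists set0 => Jh xU; case: nJ.
  have [B0 [sB0 cB0 HB]] := Jstep _ _ _ Jh xU.
  have [|B [sB1 sB2 cB]] := exists_card_between (m := minn b #|U :\ x|) sB0.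
    by rewrite geq_minr leq_min cB0 subset_leq_card.
  exists B => _ _; split; last exact: HB.
  by rewrite /legal_breaker_move -/U sB2 cB eqxx.
exists (fun h x => t (h, x)).
have Jplay h : play X b (fun h' x B => B = t (h', x)) h ->
    J (maker_set h) (unclaimed X h).
  elim=> [|h' x B _ Jh lx lB ->]; first by rewrite maker_set_nil unclaimed_nil.
  rewrite maker_set_rcons unclaimed_rcons.
  by have [] := ht (h', x) Jh lx.
move=> h /Jplay Jh; split => [x lx|Uh]; first by have [] := ht (h, x) Jh lx.
by apply: Jend; rewrite -Uh.
Qed.

End Positions.

(** * Rotations and boosters *)

Section ConsecutivePairs.
Variable T : eqType.
Implicit Types (s p q : seq T) (x y u v w : T).

Definition steps s := zip s (behead s).

Lemma steps_cat p a v q :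
  steps (rcons p a ++ v :: q) = steps (rcons p a) ++ (a, v) :: steps (v :: q).
Proof.
rewrite /steps; elim: p => [|x p IH] //=.
by case: p IH => [|y p] //= ->.
Qed.

Lemma mem_steps_rev s x y : ((x, y) \in steps (rev s)) = ((y, x) \in steps s).
Proof.
elim: s => [|u [|v s] IH] //.
have -> : rev (u :: v :: s) = rcons (rev s) v ++ [:: u].
  by rewrite !rev_cons cats1.
rewrite steps_cat -rev_cons mem_cat IH /= [in RHS]inE orbC.
by rewrite !inE !xpair_eqE andbC.
Qed.

Lemma stepsP s x y : (x, y) \in steps s -> exists p q, s = p ++ x :: y :: q.
Proof.
elim: s => [|u [|v s] IH] //.
rewrite /= inE xpair_eqE => /orP [/andP [/eqP -> /eqP ->]|/IH [p [q ->]]].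
  by exists [::], s.
by exists (u :: p), q.
Qed.

Lemma steps_succ d s x y : uniq s -> (x, y) \in steps s ->
  y = nth d s (index x s).+1.
Proof.
move=> us /stepsP [p [q def_s]]; move: us.
rewrite def_s -cat_rcons cat_uniq rcons_uniq index_cat mem_rcons mem_head.
case/andP=> /andP [xp _] _.
rewrite -cats1 index_cat (negPf xp) /= eqxx addn0 -catA nth_cat ltnNge leqnSn /=.
by rewrite subSnn.
Qed.

Lemma steps_pred d s x y : uniq s -> (x, y) \in steps s ->
  x = nth d s (index y s).-1 /\ y != head d s.
Proof.
move=> us xy; have [p [q def_s]] := stepsP xy.
have yx : y != x.
  by move: us; rewrite def_s cat_uniq /= inE eq_sym; case: eqP; rewrite ?andbF.
have yp : y \notin p.
  move: us; rewrite def_s cat_uniq => /and3P [_ + _].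
  by apply: contra => yp; apply/hasP; exists y; rewrite // !inE eqxx orbT.
rewrite def_s index_cat (negPf yp) /= eq_sym (negPf yx) eqxx addn1 /=.
rewrite nth_cat ltnn subnn; split=> //.
by case: (p) yp => [|z p'] //=; rewrite inE negb_or => /andP [].
Qed.

End ConsecutivePairs.

(** * Posa rotations of a longest path *)

Section Rotations.
Variables (V : finType) (G : rel V).
Hypothesis symG : symmetric G.
Implicit Types (s p q : seq V) (x y u v w : V) (A : {set V}).

Definition gpath s := uniq s && sorted G s.

Definition outer_nbrs A : {set V} := [set v | v \notin A & [exists u in A, G u v]].

(** A Posa rotation with the moving end kept at the head: the chord from [u] to [v] replaces the
    path edge into [v] and the prefix is reversed, so the last vertex never moves. *)
Inductive rotated s0 : seq V -> Prop :=
| Rotated0 : rotated s0 s0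
| RotatedS u p v q :
    rotated s0 (u :: p ++ v :: q) -> G u v -> rotated s0 (rev (u :: p) ++ v :: q).

Lemma rotated_gpath s0 s : rotated s0 s -> gpath s0 ->
  [/\ gpath s, perm_eq s s0 & forall x, last x s = last x s0].
Proof.
elim=> [//|u p v q _ IH uv /IH [/andP [us ss] ps ls]].
have pr : perm_eq (rev (u :: p) ++ v :: q) (u :: p ++ v :: q).
  by rewrite -[u :: p ++ _]cat_cons perm_cat2r perm_rev.
split; last by move=> x; rewrite -ls last_cat /= last_cat.
  rewrite /gpath (perm_uniq pr) us /= rev_cons cat_rcons sorted_cat_cons /=.
  move: ss; rewrite /= cat_path /= uv => /and3P [up _ ->].
  rewrite -rev_cons rev_sorted /= andbT.
  by rewrite (eq_path (e' := G)) // => a c; exact: symG.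
exact: perm_trans pr ps.
Qed.

Definition rot_ends s0 : {set V} := [set u | `[< exists p, rotated s0 (u :: p) >]].

Definition path_adj s x y := ((x, y) \in steps s) || ((y, x) \in steps s).

(* A rotation destroys one path edge, one end of which becomes a rotation end
   and the other end of which has that vertex as its path neighbour. *)
Lemma rotated_adj s0 v : v \notin rot_ends s0 ->
  (forall w, path_adj s0 v w -> w \notin rot_ends s0) ->
  forall s, rotated s0 s -> forall w, path_adj s v w -> path_adj s0 v w.
Proof.
move=> vR vN s; elim=> [//|u p x q rs IH ux w].
have uR : u \in rot_ends s0 by rewrite inE; apply/asboolP; exists (p ++ x :: q).
have vu : v != u by apply: contraNneq vR => ->.
have rs' : rotated s0 (rev (u :: p) ++ x :: q) by exact: RotatedS.
(* [a] precedes [x] on the path: the rotation deletes the edge between them and makes [a] the new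
   head. *)
have [p' [a def_p]] : exists p' a, u :: p = rcons p' a.
  case/lastP: (p) => [|p' a]; first by exists [::], u.
  by exists (u :: p'), a.
have aR : a \in rot_ends s0.
  rewrite inE; apply/asboolP; exists (rev p' ++ x :: q).
  by move: rs'; rewrite def_p rev_rcons.
move: IH; rewrite -cat_cons def_p /path_adj => IH.
have av : ~~ path_adj (rcons p' a ++ x :: q) v a.
  by apply: contraL aR => /IH; exact: vN.
rewrite -def_p rev_cons steps_cat -rev_cons def_p !mem_cat !mem_steps_rev !inE.
move: av (IH w); rewrite /path_adj steps_cat !mem_cat !inE !xpair_eqE.
rewrite (negPf vu) !eqxx /= => av.
have [xv|xv] := eqVneq v x; first by move: av; rewrite xv eqxx !orbT.
rewrite !andbF /= => {}IH H; apply: IH; move: H.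
rewrite -!orbA => /or4P [->|->|->|->]; rewrite ?orbT //.
Qed.

(** Every outer neighbour of the set of rotation ends is a successor or predecessor, on the original
    path, of a rotation end. The head is a rotation end without predecessor, which makes the
    inequality strict. *)
Lemma rot_ends_small s0 : gpath s0 -> s0 != [::] ->
  (forall s, gpath s -> size s <= size s0) ->
  #|outer_nbrs (rot_ends s0)| < 2 * #|rot_ends s0|.
Proof.
case: s0 => [//|x0 s0] /[dup] gs0 /andP [us0 _] _ longest.
set s := x0 :: s0; set R := rot_ends s.
have x0R : x0 \in R by rewrite inE; apply/asboolP; exists s0; exact: Rotated0.
pose succ x := nth x0 s (index x s).+1; pose pred x := nth x0 s (index x s).-1.
have sub : outer_nbrs R \subset (succ @: R) :|: (pred @: (R :\ x0)).
  apply/subsetP => v; rewrite inE => /andP [vR /exists_inP [u uR uv]].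
  have [w wv wR] : exists2 w, path_adj s v w & w \in R.
    (* Otherwise path neighbours of [v] in any rotated path are already neighbours in [s]. With [u]
       at the head, maximality puts [v] on the path, and rotating along the edge [u v] turns one of
       these neighbours into an end. *)
    apply: contrapT => nw.
    have vN w : path_adj s v w -> w \notin R.
      by move=> vw; apply/negP => wR; apply: nw; exists w.
    move: (uR); rewrite inE => /asboolP [p rs].
    have [/andP [/= up sp] ps ls] := rotated_gpath rs gs0.
    have vp : v \in p.
      have : v \in u :: p.
        apply: contraT => vp; have := longest (v :: u :: p).
        have /= [->] := perm_size ps; rewrite ltnn; apply.
        by rewrite /gpath cons_uniq vp /= up symG uv sp.
      by rewrite inE => /orP [/eqP vu|//]; rewrite vu uR in vR.
    move: rs => {up sp ps ls}; case/splitPr: vp => p1 p2 rs.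
    have := RotatedS rs uv; set a := last u p1.
    have [p' def_p] : exists p', u :: p1 = rcons p' a.
      by exists (belast u p1); rewrite -lastI.
    rewrite def_p rev_rcons => ra.
    have aR : a \in R by rewrite inE; apply/asboolP; exists (rev p' ++ v :: p2).
    have av : path_adj (u :: p1 ++ v :: p2) v a.
      by rewrite -cat_cons def_p /path_adj steps_cat !mem_cat !inE eqxx !orbT.
    by have := vN _ (rotated_adj vR vN rs av); rewrite aR.
  rewrite inE; case/orP: wv => [vw|wv].
    have [v_pred wx0] := steps_pred x0 us0 vw.
    by apply/orP; right; apply/imsetP; exists w => //; rewrite in_setD1 wR andbT.
  by apply/orP; left; apply/imsetP; exists w => //; exact: steps_succ.
apply: leq_ltn_trans (subset_leq_card sub) _.
apply: leq_ltn_trans (leq_card_setU _ _) _.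
apply: leq_ltn_trans (leq_add (leq_imset_card _ _) (leq_imset_card _ _)) _.
by rewrite mul2n -addnn ltn_add2l [X in _ < X](cardsD1 x0) x0R.
Qed.

End Rotations.

(** * Boosters of an expander *)

Section Boosters.
Variable V : finType.
Implicit Types (G : rel V) (s p q : seq V) (x y u v w : V) (A : {set V}).

Definition expander G k0 :=
  forall A, 0 < #|A| <= k0 -> 2 * #|A| <= #|outer_nbrs G A|.

Definition hamiltonian G := exists s, [/\ uniq s, size s = #|V| & cycle G s].

Definition has_path G l := exists2 s, gpath G s & size s = l.

Lemma expanderS G G' k0 : subrel G G' -> expander G k0 -> expander G' k0.
Proof.
move=> sG eG A /eG h; apply: leq_trans h (subset_leq_card _).
apply/subsetP => v; rewrite !inE => /andP [-> /exists_inP [u uA /sG uv]].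
by apply/exists_inP; exists u.
Qed.

Lemma gpathS G G' s : subrel G G' -> gpath G s -> gpath G' s.
Proof. by rewrite /gpath => sG /andP [-> /(sub_sorted sG) ->]. Qed.

Lemma card_dep_pairs (R : {set V}) (F : V -> {set V}) :
  #|[set xy : V * V | (xy.1 \in R) && (xy.2 \in F xy.1)]| = \sum_(x in R) #|F x|.
Proof.
under [RHS]eq_bigr do rewrite -sum1_card.
rewrite pair_big_dep /= -sum1_card; apply: eq_bigl => xy.
by rewrite inE.
Qed.

Lemma large_dep_pairs (R : {set V}) (F : V -> {set V}) m : m <= #|R| ->
  (forall x, x \in R -> m <= #|F x|) ->
  m * m <= #|[set xy : V * V | (xy.1 \in R) && (xy.2 \in F xy.1)]|.
Proof.
move=> mR mF; rewrite card_dep_pairs; apply: leq_trans (leq_mul mR (leqnn m)) _.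
by rewrite -sum_nat_const leq_sum.
Qed.

Lemma rot_ends_large G k0 s0 : symmetric G -> expander G k0 ->
  gpath G s0 -> s0 != [::] -> (forall s, gpath G s -> size s <= size s0) ->
  k0 <= #|rot_ends G s0|.
Proof.
move=> sG eG gs0 s0N long; rewrite leqNgt; apply/negP => small.
have := rot_ends_small sG gs0 s0N long; rewrite ltnNge eG // (ltnW small) andbT.
case: s0 {gs0 s0N long small} => [//|x s0] in s0N *.
by apply/card_gt0P; exists x; rewrite inE; apply/asboolP; exists s0; constructor.
Qed.

Lemma gpath_cycle_extend G s a w : symmetric G -> uniq s -> cycle G s ->
  a \in s -> w \notin s -> G a w -> has_path G (size s).+1.
Proof.
move=> sG us cs /rot_to [i s' def_s'] ws aw.
exists (w :: a :: s'); last by rewrite -(size_rot i s) def_s'.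
rewrite /gpath -def_s' cons_uniq mem_rot ws rot_uniq us def_s' /= sG aw /=.
by move: cs; rewrite -(rot_cycle i) def_s' /= rcons_path => /andP [].
Qed.

(** If the longest path spans [V] or some edge leaves it, joining its two ends gives a Hamilton
    cycle or a cycle that opens into a longer path; rotating both ends yields many such pairs.
    Otherwise the complement of the path has no outer neighbours, so expansion makes it large, and
    joining an end to any vertex of it lengthens the path. *)
Lemma boosters G k0 l : symmetric G -> expander G k0 -> 0 < #|V| -> 0 < k0 ->
  has_path G l -> (forall s, gpath G s -> size s <= l) ->
  exists2 B : {set V * V}, k0 * k0 <= #|B| &
    forall x y, (x, y) \in B -> x != y /\
      forall G', symmetric G' -> subrel G G' -> G' x y ->
        hamiltonian G' \/ has_path G' l.+1.
Proof.
move=> sG eG V0 k0P [s0 gs0 ls0] long.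
have l_ge2 : 2 <= l.
  have /card_gt0P [u _] := V0.
  have := eG [set u]; rewrite cards1 k0P => /(_ isT).
  move/(leq_trans (isT : 0 < 2 * 1)) => /card_gt0P [v]; rewrite inE.
  case/andP => vu /exists_inP [u' /set1P -> uv].
  have := long [:: u; v]; rewrite /gpath /= uv !andbT inE; apply.
  by rewrite inE eq_sym in vu.
have s0N : s0 != [::] by case: (s0) ls0 l_ge2 => // <-.
have long0 s : gpath G s -> size s <= size s0 by rewrite ls0; exact: long.
have endP u : u \in rot_ends G s0 -> exists p, [/\ gpath G (u :: p),
    perm_eq (u :: p) s0 & forall x, last x (u :: p) = last x s0].
  by rewrite inE => /asboolP [p rp]; exists p; exact: rotated_gpath rp gs0.
have R0 := rot_ends_large sG eG gs0 s0N long0.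
have [crossing|nocross] :=
  boolP ((#|s0| == #|V|) || [exists u in s0, exists w, (w \notin s0) && G u w]).
(* Reversing the path makes its end [u] the fixed one; a second family of rotations gives [u] at
   least [k0] partners. *)
- have /choice [F FP] : forall u, exists Fu : {set V},
      u \in rot_ends G s0 -> k0 <= #|Fu| /\ forall v, v \in Fu ->
        exists p, [/\ gpath G (v :: p), perm_eq (v :: p) s0 &
                      last v p = u].
    move=> u; case: (boolP (u \in _)) => [uR|_]; last by exists set0.
    have [p [gp pp lp]] := endP u uR.
    have gr : gpath G (rev (u :: p)).
      move: gp; rewrite /gpath rev_uniq rev_sorted /= => /andP [-> /=].
      by rewrite (eq_path (e' := G)) // => a c; exact: sG.
    have pr : perm_eq (rev (u :: p)) s0 by rewrite perm_rev.
    have rN : rev (u :: p) != [::] by rewrite -size_eq0 size_rev.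
    exists (rot_ends G (rev (u :: p))) => _; split.
      by apply: rot_ends_large => // s /long0; rewrite (perm_size pr).
    move=> v; rewrite inE => /asboolP [q rq].
    have [gq pq lq] := rotated_gpath sG rq gr.
    exists q; split => //; first exact: perm_trans pq pr.
    by have := lq v; rewrite /= rev_cons last_rcons.
  exists [set xy | (xy.1 \in rot_ends G s0) && (xy.2 \in F xy.1)].
    by apply: large_dep_pairs => // x /FP [].
  move=> x y; rewrite inE /= => /andP [/FP [_ FxP] /FxP [p [gp pp lp]]].
  move: (gp) => /andP [up sp].
  have szp : (size p).+1 = l by rewrite -ls0 -(perm_size pp).
  have xNy : x != y.
    case: p lp szp up {gp pp sp} => [|z p] /=; first by move=> _ szp; rewrite -szp in l_ge2.
    move=> <- _ /and3P [+ _ _]; apply: contraNneq => <-; exact: mem_last.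
  split=> // G' sG' GG' xy.
  have cp : cycle G' (y :: p).
    by rewrite /= rcons_path lp xy andbT; exact: sub_path GG' _ _ sp.
  case/orP: crossing => [/eqP sV|/exists_inP [u us0 /existsP [w /andP [ws0 uw]]]].
    left; exists (y :: p); split=> //; rewrite -sV.
    by have /card_uniqP <- := up; apply: eq_card; exact: perm_mem.
  right; rewrite -szp -[(size p).+1]/(size (y :: p)).
  by apply: (gpath_cycle_extend (a := u) (w := w)); rewrite ?(perm_mem pp) ?GG'.
move: nocross; rewrite negb_or => /andP [sV].
rewrite negb_exists_in => /forall_inP nocross.
pose K := ~: [set x in s0].
have K0 : k0 <= #|K|.
  rewrite leqNgt; apply/negP => small.
  have KN : 0 < #|K|.
    by rewrite cardsCs setCK cardsE subn_gt0 ltn_neqAle sV max_card.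
  have := eG K; rewrite KN (ltnW small) => /(_ isT).
  suff -> : outer_nbrs G K = set0 by rewrite cards0 leqn0 muln_eq0 /= -leqn0 leqNgt KN.
  apply/setP => v; rewrite !inE negbK; apply/negP => /andP [vs].
  case/exists_inP => u; rewrite !inE => us uv.
  by have := nocross v vs; rewrite negb_exists => /forallP /(_ u); rewrite us sG uv.
exists [set xy | (xy.1 \in rot_ends G s0) && (xy.2 \in K)].
  exact: (@large_dep_pairs _ (fun=> K)).
move=> x y; rewrite inE /= => /andP [/endP [p [gp pp _]]]; rewrite !inE => ys.
split=> [|G' sG' GG' xy].
  by apply: contraNneq ys => <-; rewrite -(perm_mem pp) mem_head.
right; exists (y :: x :: p); last by rewrite -ls0 -(perm_size pp).
have /andP [up sp] := gpathS GG' gp.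
by rewrite /gpath cons_uniq (perm_mem pp) ys up /= sG' xy.
Qed.

End Boosters.

(** * The danger invariant *)

Lemma card_draws_superset (T : finType) (S : {set T}) (k : nat) : #|S| <= k ->
  #|[set e : {set T} | (#|e| == k) && (S \subset e)]| = 'C(#|T| - #|S|, k - #|S|).
Proof.
move=> Sk; have <- : #|~: S| = #|T| - #|S| by rewrite [#|~: S|]cardsCs setCK.
rewrite -cards_draws -(@card_in_imset _ _ (fun e => e :\: S)); last first.
  move=> e f; rewrite !inE => /andP [_ Se] /andP [_ Sf] eq_ef.
  by rewrite -(setID e S) -(setID f S) eq_ef (setIidPr Se) (setIidPr Sf).
apply: eq_card => f; rewrite inE; apply/imsetP/andP => [[e]|[fS /eqP fk]].
  rewrite inE => /andP [/eqP <- Se] ->; split; first by rewrite setDE subsetIr.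
  by rewrite cardsD (setIidPr Se).
have fS0 : f :&: S = set0.
  by apply/setP => x; rewrite !inE; apply/andP => -[/(subsetP fS)]; rewrite inE => /negPf ->.
exists (f :|: S); last first.
  apply/setP => x; rewrite !inE; case xf : (x \in f) => /=; last by rewrite andNb.
  by have := subsetP fS _ xf; rewrite inE => ->.
by rewrite inE cardsU fS0 cards0 subn0 fk subnK // eqxx subsetUr.
Qed.

Lemma card_set_sum (T : finType) (A : {set T}) (P : pred T) :
  #|[set x in A | P x]| = \sum_(x in A) P x.
Proof.
rewrite -sum1_card big_mkcond [RHS]big_mkcond /=; apply: eq_bigr => x _.
by rewrite inE; case: (x \in A); case: (P x).
Qed.

Section Degrees.
Variables (n k : nat).
Notation V := 'I_n.
Notation X := (complete_hypergraph n k).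
Notation Q := 'C(n - 2, k - 2).
Implicit Types (C N : {set {set V}}) (J : {set V}) (u v w : V).

Definition deg C v := #|[set e in C | v \in e]|.
Definition touch C J := #|[set e in C | e :&: J != set0]|.

Lemma deg_complete v : 0 < k -> deg X v = 'C(n.-1, k.-1).
Proof.
move=> k0; have := @card_draws_superset _ [set v] k.
rewrite cards1 card_ord !subn1 => <- //; apply: eq_card => e.
by rewrite !inE sub1set.
Qed.

Lemma codeg_complete u v : 1 < k -> u != v ->
  #|[set e in X | (u \in e) && (v \in e)]| = Q.
Proof.
move=> k1 uv; have := @card_draws_superset _ [set u; v] k.
rewrite cards2 uv card_ord => <- //; apply: eq_card => e.
by rewrite !inE subUset !sub1set.
Qed.

Lemma sum_deg C J : \sum_(v in J) deg C v = \sum_(e in C) #|e :&: J|.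
Proof.
under eq_bigr do rewrite /deg card_set_sum.
rewrite exchange_big; apply: eq_bigr => e eC /=.
by rewrite -card_set_sum; apply: eq_card => v; rewrite !inE andbC.
Qed.

Lemma touch_le_sum_deg C J : touch C J <= \sum_(v in J) deg C v.
Proof.
rewrite sum_deg /touch card_set_sum; apply: leq_sum => e _.
by rewrite -card_gt0; case: #|_|.
Qed.

Lemma deg_sub C C' v : C \subset C' -> deg C v <= deg C' v.
Proof.
move=> CC; apply: subset_leq_card; apply/subsetP => e.
by rewrite !inE => /andP [/(subsetP CC) -> ->].
Qed.

Lemma touch_setU C N J : touch (C :|: N) J <= touch C J + #|N|.
Proof.
apply: leq_trans (leq_add (leqnn _) (subset_leq_card (subsetIl N [set e | e :&: J != set0]))).
apply: leq_trans (leq_card_setU _ _); apply: subset_leq_card.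
by apply/subsetP => e; rewrite !inE => /andP [/orP [->|->] ->]; rewrite ?orbT.
Qed.

Lemma sum_deg_setU C N J : N \subset X ->
  \sum_(v in J) deg (C :|: N) v <= \sum_(v in J) deg C v + k * #|N|.
Proof.
move=> NX; apply: (@leq_trans (\sum_(v in J) deg C v + \sum_(v in J) deg N v)).
  rewrite -big_split; apply: leq_sum => v _.
  apply: leq_trans (leq_card_setU _ _); apply: subset_leq_card.
  by apply/subsetP => e; rewrite !inE => /andP [/orP [->|->] ->]; rewrite ?orbT.
rewrite leq_add2l sum_deg mulnC -sum_nat_const.
apply: leq_sum => e /(subsetP NX); rewrite inE => /eqP <-.
exact: subset_leq_card (subsetIl _ _).
Qed.

(** An edge at [v] is newly touched unless it also meets [J]; through the codegrees there are at
    most [#|J| * Q] such exceptions. *)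
Lemma touch_setU1 C J v : 1 < k -> C \subset X -> v \notin J ->
  touch C J + deg C v <= touch C (v |: J) + #|J| * Q.
Proof.
move=> k1 CX vJ.
have bound : \sum_(e in C) (v \in e) * #|e :&: J| <= #|J| * Q.
  rewrite -sum_nat_const.
  apply: (@leq_trans (\sum_(u in J) \sum_(e in C) ((v \in e) && (u \in e)))).
    rewrite exchange_big /=; apply: leq_sum => e eC.
    rewrite -[#|_|]/#|[set u | (u \in e) && (u \in J)]|.
    case: (v \in e) => //=; rewrite mul1n -card_set_sum.
    by apply: subset_leq_card; apply/subsetP => u; rewrite !inE andbC.
  apply: leq_sum => u uJ; have vu : v != u by apply: contraNneq vJ => ->.
  rewrite -card_set_sum -(codeg_complete k1 vu); apply: subset_leq_card.
  by apply/subsetP => e; rewrite !inE => /andP [/(subsetP CX)]; rewrite inE => -> ->.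
apply: leq_trans (leq_add (leqnn _) bound).
rewrite /touch /deg !card_set_sum -!big_split; apply: leq_sum => e _ /=.
case ve : (v \in e) => /=; last first.
  rewrite mul0n !addn0; case: (set0Pn (e :&: J)) => // -[u]; rewrite inE => /andP [ue uJ].
  by rewrite lt0b; apply/set0Pn; exists u; rewrite !inE ue uJ orbT.
have -> : e :&: (v |: J) != set0 by apply/set0Pn; exists v; rewrite !inE ve eqxx.
by rewrite mul1n addnC leq_add2l -card_gt0; case: #|_|.
Qed.
End Degrees.

(** * Danger averaged over sets of vertices *)

Section DangerInvariant.
Import Order.TTheory GRing.Theory Num.Theory.
Variables (R : realFieldType) (n k a m c : nat).
Hypothesis k1 : 1 < k.
Notation V := 'I_n.
Notation X := (complete_hypergraph n k).
Notation Q := 'C(n - 2, k - 2).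
Implicit Types (C N : {set {set V}}) (J : {set V}) (own : V -> nat) (u v w : V).
Local Open Scope ring_scope.

(** The price per vertex of passing from a set of [i + 1] vertices to one of [i]: one round's
    allowance shared among [i + 1] vertices, plus a codegree when edges are counted only once. *)
Definition danger_incr (i : nat) : R :=
  if (i < m)%N then a%:R / i.+1%:R + Q%:R else (k * a)%:R / i.+1%:R.

Definition danger_cap (j : nat) : R := \sum_(j <= i < n) danger_incr i.

(* Once [J] is small, an edge meeting [J] is counted only once: this is what
   makes the bias [a] rather than [k * a] govern the end of the game. *)
Definition danger_inv C own := forall J, (forall u, u \in J -> (own u < c)%N) ->
  ((#|J| <= m)%N -> (touch C J)%:R <=
     (k * a * \sum_(u in J) own u)%N%:R + #|J|%:R * danger_cap #|J| + a%:R) /\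
  ((m < #|J|)%N -> (\sum_(u in J) deg C u)%N%:R <=
     (k * a * \sum_(u in J) own u)%N%:R + #|J|%:R * danger_cap #|J| + (k * a)%:R).

Lemma danger_incr_ge0 i : 0 <= danger_incr i.
Proof. by rewrite /danger_incr; case: ifP => _; rewrite ?addr_ge0 ?divr_ge0. Qed.

Lemma danger_cap_ge0 j : 0 <= danger_cap j.
Proof. by apply: sumr_ge0 => i _; exact: danger_incr_ge0. Qed.

Lemma danger_inv0 : danger_inv set0 (fun=> 0).
Proof.
move=> J _; have nn x : 0 <= (k * a * \sum_(u in J) 0)%N%:R + #|J|%:R * danger_cap #|J| + x%:R.
  by rewrite !addr_ge0 ?mulr_ge0 ?danger_cap_ge0.
have S0 : (\sum_(u in J) deg set0 u = 0)%N.
  by apply: big1 => u _; apply: eq_card0 => e; rewrite !inE.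
split=> _; last by rewrite S0.
apply: le_trans (nn a); rewrite lern0 -leqn0 -S0; exact: touch_le_sum_deg.
Qed.

(** If [v] lies in [J], the choice it makes contributes [k * a], which pays for the round. Otherwise
    the invariant is applied to [v |: J]; since [v] has the largest danger, removing it lowers the
    average over the set. *)
Lemma danger_step C N own v : C \subset X -> N \subset X -> (#|N| <= a)%N ->
  (own v < c)%N ->
  (forall u, (own u < c)%N -> (deg C u + k * a * own v <= deg C v + k * a * own u)%N) ->
  danger_inv C own -> danger_inv (C :|: N) (fun u => own u + (u == v))%N.
Proof.
move=> CX NX Na vc vmax inv J Jc.
have JU u : u \in J -> (own u < c)%N by move=> /Jc; apply: leq_ltn_trans (leq_addr _ _).
set W' := \sum_(u in J) (own u + (u == v))%N.
(* [key] is the invariant with the new choice counted but without the allowance for one round;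
   adding [N] then consumes that allowance. *)
have key : ((#|J| <= m)%N -> (touch C J)%:R <=
     (k * a * W')%N%:R + #|J|%:R * danger_cap #|J|) /\
   ((m < #|J|)%N -> (\sum_(u in J) deg C u)%N%:R <=
     (k * a * W')%N%:R + #|J|%:R * danger_cap #|J|).
  have [vJ|vJ] := boolP (v \in J).
    have -> : W' = (\sum_(u in J) own u).+1.
      rewrite /W' big_split /= -addn1; congr addn.
      by rewrite (bigD1 v) //= eqxx big1 ?addn0 // => u /andP [_ /negPf ->].
    have [h1 h2] := inv J JU; rewrite mulnS natrD; split=> [/h1|/h2] h.
      have : a%:R <= (k * a)%:R :> R by rewrite ler_nat leq_pmull // ltnW.
      lra.
    lra.
  have -> : W' = \sum_(u in J) own u.
    apply: eq_bigr => u uJ; case: eqP => [uv|]; last by rewrite addn0.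
    by rewrite uv (negPf vJ) in uJ.
  have J1c u : u \in v |: J -> (own u < c)%N.
    by rewrite !inE => /orP [/eqP ->|/JU].
  have [h1 h2] := inv _ J1c.
  have cJ : #|v |: J| = #|J|.+1 by rewrite cardsU1 vJ.
  rewrite cJ !(big_setU1 _ vJ) /= in h1 h2.
  have jn : (#|J| < n)%N.
    by rewrite -cJ -[leqRHS](card_ord n) max_card.
  have capS : danger_cap #|J| = danger_incr #|J| + danger_cap #|J|.+1.
    by rewrite /danger_cap big_ltn.
  have avg : (\sum_(u in J) deg C u + #|J| * (k * a * own v) <=
      #|J| * deg C v + k * a * \sum_(u in J) own u)%N.
    rewrite -!sum_nat_const big_distrr /= -!big_split.
    by apply: leq_sum => u /JU; exact: vmax.
  have tS := touch_le_sum_deg C J.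
  have tU := touch_setU1 k1 CX vJ.
  rewrite capS /danger_incr.
  move: h1 h2 avg tS tU; move: (touch C J) (touch C (v |: J)) (deg C v) => T T1 dv.
  move: (\sum_(u in J) deg C u)%N (\sum_(u in J) own u)%N (own v) => S W ov.
  move: (danger_cap _) jn {cJ capS} => F.
  move: #|J| => j jn h1 h2 avg tS tU.
  rewrite -(ler_nat R) !(natrD, natrM) in avg; rewrite -(ler_nat R) in tS.
  rewrite -(ler_nat R) !(natrD, natrM) in tU.
  have j0 : 0 <= j%:R :> R by [].
  have jS : j.+1%:R = j%:R + 1 :> R by rewrite -natr1.
  have j1 : 0 < j%:R + 1 :> R by lra.
  have Q0 : 0 <= Q%:R :> R by [].
  move: h1 h2; rewrite !(natrD, natrM) !jS.
  set g := (a%:R / (j%:R + 1) : R).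
  have gE : a%:R = g * (j%:R + 1) by rewrite /g divfK // gt_eqF.
  have -> : k%:R * a%:R / (j%:R + 1) = k%:R * g :> R by rewrite /g mulrA.
  case: ltnP => jm h1 h2.
    have {h2}h1 := h1 isT; split=> [_|mj]; last by have := ltn_trans jm mj; rewrite ltnn.
    have dvT : T%:R + (dv%:R - k%:R * a%:R * ov%:R) <=
        k%:R * a%:R * W%:R + (j%:R + 1) * F + a%:R + j%:R * Q%:R :> R by lra.
    have := ler_wpM2l j0 dvT => {}dvT.
    rewrite -subr_ge0 -(pmulr_rge0 _ j1).
    have : 0 <= j%:R * Q%:R :> R by exact: mulr_ge0.
    rewrite gE in dvT avg h1 *.
    lra.
  (* Here [v |: J] has more than [m] vertices, so its bound concerns degree sums; [tS] carries it
     over to [touch C J] in the boundary case [j = m]. *)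
  have {h1}h2 := h2 jm.
  have dvS : S%:R + (dv%:R - k%:R * a%:R * ov%:R) <=
      k%:R * a%:R * W%:R + (j%:R + 1) * F + k%:R * a%:R :> R by lra.
  have {}dvS := ler_wpM2l j0 dvS.
  suff H : S%:R <= k%:R * a%:R * W%:R + j%:R * (k%:R * g + F).
    by split=> // _; apply: le_trans tS H.
  rewrite -subr_ge0 -(pmulr_rge0 _ j1).
  rewrite gE in dvS avg *.
  lra.
have [h1 h2] := key; split=> [/h1|/h2] h.
  apply: le_trans (lerD h (_ : a%:R <= a%:R)) => //.
  rewrite -natrD ler_nat; apply: leq_trans (touch_setU _ _ _) _.
  by rewrite leq_add2l.
apply: le_trans (lerD h (lexx (k * a)%:R)).
rewrite -natrD ler_nat; apply: leq_trans (sum_deg_setU _ _ NX) _.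
by rewrite leq_add2l leq_mul2l Na orbT.
Qed.

Lemma danger_bound C own v : (0 < m)%N -> (own v < c)%N -> danger_inv C own ->
  (deg C v)%:R <= (k * a * c)%:R + danger_cap 1 + a%:R.
Proof.
move=> m0 vc inv; have [u /set1P ->//|+ _] := inv [set v].
rewrite cards1 big_set1 mul1r => /(_ m0) h.
have -> : deg C v = touch C [set v].
  by apply: eq_card => e; rewrite !inE -card_gt0 setIC; case ve: (v \in e);
    [rewrite (setIidPl _) ?cards1 ?sub1set |
     rewrite (disjoint_setI0 _) ?cards0 // disjoints1 ve].
apply: le_trans h _; rewrite !lerD2r ler_nat leq_mul2l (ltnW vc) orbT //.
Qed.

End DangerInvariant.

(** * Derandomised expansion *)

Section BinomialBounds.

Lemma bin_le_exp2 n m : 'C(n, m) <= 2 ^ n.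
Proof.
rewrite -[n in 'C(n, _)]card_ord -card_draws; apply: leq_trans (max_card _) _.
by rewrite (eq_card (B := powerset [set: 'I_n])) ?card_powerset ?cardsT ?card_ord
  // => A; rewrite !inE subsetT.
Qed.

(** A substitute for Stirling's formula: each of the [i] factors of the falling factorial
    [(2 * i) ^_ i] is at least [i]. *)
Lemma expnn_le_fact i : i ^ i <= 4 ^ i * i`!.
Proof.
apply: (@leq_trans ((2 * i) ^_ i)).
  rewrite ffact_prod -[X in _ ^ X]card_ord -prod_nat_const.
  by apply: leq_prod => j _; have := ltn_ord j; lia.
by rewrite -bin_ffact leq_mul2r -(expnM 2 2 i) bin_le_exp2 orbT.
Qed.

Lemma bin_mul_expnn n i : 'C(n, i) * i ^ i <= (4 * n) ^ i.
Proof.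
apply: leq_trans (leq_mul (leqnn _) (expnn_le_fact i)) _.
rewrite mulnCA bin_ffact expnMn leq_mul2l; apply/orP; right.
rewrite ffact_prod -[X in _ ^ X]card_ord -prod_nat_const.
by apply: leq_prod => j _; exact: leq_subr.
Qed.

(* 9216 = 4 ^ 4 * 36: the binomials cost [4 ^ 4], and [36 = 3 ^ 2 * 4] comes from
   [(3 * i) ^ (2 * i)] and from the ratio [1 / 4] of the geometric series below. *)
Lemma bin_bin_bound n k0 q i : 9216 * n ^ 4 * k0 <= q ^ 5 -> i <= k0 ->
  4 ^ i * ('C(n, i) * 'C(n, 3 * i) * (3 * i) ^ (5 * i)) <= q ^ (5 * i).
Proof.
move=> hq ik.
have e : (3 * i) ^ (5 * i) * 4 ^ i = i ^ i * (3 * i) ^ (3 * i) * (36 * i) ^ i.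
  have -> : 5 * i = i + i + 3 * i by lia.
  have -> : 36 = 3 * 3 * 4 by [].
  rewrite !expnD !expnMn; ring.
have -> : 4 ^ i * ('C(n, i) * 'C(n, 3 * i) * (3 * i) ^ (5 * i)) =
    ('C(n, i) * i ^ i) * ('C(n, 3 * i) * (3 * i) ^ (3 * i)) * (36 * i) ^ i.
  by rewrite mulnC -!mulnA e; ring.
have h1 := bin_mul_expnn n i; have h2 := bin_mul_expnn n (3 * i).
apply: leq_trans (leq_mul (leq_mul h1 h2) (leqnn _)) _.
rewrite (expnM _ 3) (expnM q) -!expnMn.
case: i ik {e h1 h2} => [//|i] ik; rewrite leq_exp2r //; apply: leq_trans hq.
have -> : 4 * n * (4 * n) ^ 3 * (36 * i.+1) = 9216 * n ^ 4 * i.+1 by rewrite !expnMn; ring.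
by rewrite leq_mul2l ik orbT.
Qed.

End BinomialBounds.

(** * Conditional expectations *)

Section Potential.
Import Order.TTheory GRing.Theory Num.Theory.
Variables (R : realFieldType) (V : finType) (k0 q c : nat).
Implicit Types (al : {set V} -> {set V} -> bool) (own : V -> nat) (A D : {set V}) (v w : V).
Local Open Scope ring_scope.

(* The conditional expectation of the number of pairs [(A, D)] with [al A D]
   when every vertex [v] of [A] has [c - own v] more random choices to make, each
   of which falls into [D] with probability at most [#|D| / q]. *)
Definition pot al own : R :=
  \sum_(A : {set V} | (0 < #|A| <= k0)%N) \sum_(D : {set V} | #|D| == (3 * #|A|)%N)
    (al A D)%:R * ((3 * #|A|)%:R / q%:R) ^+ (\sum_(v in A) (c - own v))%N.

(** Average over [w] in [Fr]: when [v] is in [A], at most [#|D| = 3 * #|A|] of at least [q] choices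
    keep [(A, D)] alive, and this ratio is at most the factor released by lowering the exponent.
    Hence some [w] does not raise the potential. *)
Lemma pot_step al own v (Fr : {set V}) : (own v < c)%N -> (0 < q <= #|Fr|)%N ->
  exists2 w, w \in Fr &
    pot (fun A D => al A D && ((v \in A) ==> (w \in D)))
        (fun u => own u + (u == v))%N <= pot al own.
Proof.
move=> vc /andP [q0 qF].
apply: contrapT => nex.
have lt_w w : w \in Fr -> pot al own <
    pot (fun A D => al A D && ((v \in A) ==> (w \in D))) (fun u => own u + (u == v))%N.
  by move=> wF; rewrite ltNge; apply/negP => h; apply: nex; exists w.
have [w0 w0F] : exists w, w \in Fr by apply/card_gt0P; exact: leq_trans q0 qF.
have : \sum_(w in Fr) pot al own < \sum_(w in Fr)
    pot (fun A D => al A D && ((v \in A) ==> (w \in D))) (fun u => own u + (u == v))%N.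
  by apply: ltr_sum => //; apply/hasP; exists w0; rewrite ?mem_index_enum.
apply/negP; rewrite -leNgt /pot exchange_big [leRHS]exchange_big /=.
apply: ler_sum => A _; rewrite exchange_big [leRHS]exchange_big /=.
apply: ler_sum => D /eqP cD.
set p := _ / _; have p0 : 0 <= p by rewrite divr_ge0.
have [vA|vA] := boolP (v \in A); last first.
  under eq_bigr do rewrite /= andbT.
  rewrite le_eqVlt; apply/orP; left; apply/eqP; apply: eq_bigr => w _.
  congr (_ * _ ^+ _); apply: eq_bigr => u uA; case: eqP => [uv|]; rewrite ?addn0 //.
  by rewrite -uv uA in vA.
have -> : (\sum_(u in A) (c - own u) =
    (\sum_(u in A) (c - (own u + (u == v)))).+1)%N.
  rewrite (bigD1 v) // [in RHS](bigD1 v) //= eqxx addn1 -addSn subnSK //.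
  by congr addn; apply: eq_bigr => u /andP [_ /negPf ->]; rewrite addn0.
set E := (\sum_(u in A) _)%N.
rewrite -mulr_suml sumr_const -mulr_natl exprS mulrA.
rewrite [leRHS](_ : _ = (#|Fr|%:R * p * (al A D)%:R) * p ^+ E); last by ring.
rewrite ler_wpM2r ?exprn_ge0 //.
case: (al A D) => /=; last by rewrite big1 // mulr0.
rewrite mulr1 -natr_sum /= -card_set_sum.
apply: (@le_trans _ _ (3 * #|A|)%:R).
  by rewrite ler_nat -cD; apply: subset_leq_card; apply/subsetP => w; rewrite inE => /andP [].
rewrite /p mulrCA ler_peMr // ler_pdivlMr ?ltr0n // mul1r ler_nat //.
Qed.

(** With no choices left all exponents vanish, so a single living pair would contribute 1. *)
Lemma pot_all_dead al own : pot al own < 1 -> (forall v, c <= own v)%N ->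
  forall A D, (0 < #|A| <= k0)%N -> #|D| = (3 * #|A|)%N -> ~~ al A D.
Proof.
move=> lt1 cown A D hA hD; apply/negP => alAD; move: lt1; apply/negP; rewrite -leNgt.
have nn (A' D' : {set V}) : 0 <= (al A' D')%:R *
    ((3 * #|A'|)%:R / q%:R) ^+ (\sum_(v in A') (c - own v)) :> R.
  by rewrite mulr_ge0 ?exprn_ge0 ?divr_ge0.
rewrite /pot (bigD1 A) //= (bigD1 D) /=; last by rewrite hD.
rewrite alAD big1 ?expr0 ?mulr1; last by move=> v _; apply/eqP; rewrite subn_eq0.
rewrite -addrA lerDl addr_ge0 //.
  by apply: sumr_ge0 => D' _; rewrite mulr1.
by apply: sumr_ge0 => A' _; apply: sumr_ge0.
Qed.

End Potential.

Section InitialPotential.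
Import Order.TTheory GRing.Theory Num.Theory.
Local Open Scope ring_scope.

Lemma geom4_sum (R : realFieldType) m : \sum_(i < m) (4%:R^-1) ^+ i.+1 <= 2%:R^-1 :> R.
Proof.
have -> : \sum_(i < m) (4%:R^-1) ^+ i.+1 = 3%:R^-1 * (1 - 4%:R^-1 ^+ m) :> R.
  elim: m => [|m IH]; first by rewrite big_ord0 expr0 subrr mulr0.
  by rewrite big_ord_recr /= IH !exprS; field.
have : 0 <= 4%:R^-1 ^+ m :> R by rewrite exprn_ge0 // invr_ge0.
lra.
Qed.

(** The sets [A] of size [i] contribute at most [4 ^ - i] in total, by [bin_bin_bound], and the
    geometric series stays below 1. *)
Lemma pot_init (R : realFieldType) (V : finType) k0 q : (0 < q)%N ->
  (9216 * #|V| ^ 4 * k0 <= q ^ 5)%N ->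
  @pot R V k0 q 5 (fun _ _ => true) (fun=> 0%N) < 1.
Proof.
move=> q0 hq; apply: (@le_lt_trans _ _ (2%:R^-1)); last by lra.
apply: le_trans (@geom4_sum R k0).
have [->|k0P] := posnP k0.
  by rewrite big_ord0 /pot big1 // => A; case: #|A|.
case: k0 k0P hq => [//|k1] _ hq; rewrite /pot.
pose f (A : {set V}) : 'I_k1.+1 := inord #|A|.-1.
rewrite (partition_big f xpredT) //=; apply: ler_sum => i _.
rewrite (eq_bigl (fun A : {set V} => #|A| == i.+1)); last first.
  move=> A; rewrite /f; case: #|A| => [|a] //=; rewrite ltnS eqSS.
  apply/andP/eqP => [[ak /eqP <-]|->]; first by rewrite inordK.
  by rewrite inord_val -ltnS ltn_ord.
rewrite (eq_bigr (fun=> 'C(#|V|, 3 * i.+1)%:R *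
    ((3 * i.+1)%:R / q%:R) ^+ (5 * i.+1))); last first.
  move=> A /eqP cA; rewrite (eq_bigr (fun=> ((3 * i.+1)%:R / q%:R) ^+ (5 * i.+1))).
    rewrite cA sumr_const -[LHS]mulr_natl -card_draws; congr (_%:R * _).
    by apply: eq_card => D; rewrite !inE.
  by move=> D _; rewrite mul1r subn0 sum_nat_const cA [(i.+1 * 5)%N]mulnC.
rewrite sumr_const -cardsE card_draws -[leLHS]mulr_natl exprMn exprVn.
rewrite !mulrA -[leRHS]mul1r exprVn ler_pdivlMr ?exprn_gt0 ?ltr0n //.
rewrite mulrAC ler_pdivrMr ?exprn_gt0 ?ltr0n // mul1r.
rewrite -!natrX -!natrM ler_nat.
rewrite [(_ * 4 ^ _)%N]mulnC; exact: (bin_bin_bound hq (ltn_ord i)).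
Qed.
End InitialPotential.

(** * Maker's strategy *)

Section PairGraph.
Variable n : nat.
Notation V := 'I_n.
Implicit Types (M U B : {set {set V}}) (phi : {set V} -> V * V) (e : {set V}) (A D : {set V}).

Definition pair_graph phi M : rel V :=
  fun x y => [exists e in M, (phi e == (x, y)) || (phi e == (y, x))].

(** The pair [phi e] is ordered: its first vertex is the one that made the choice. *)
Definition own phi M v := #|[set e in M | (phi e).1 == v]|.

(** A living pair witnesses failed expansion: [D] stands for [A] together with its few
    neighbours. *)
Definition alive phi M A D :=
  [forall e in M, ((phi e).1 \in A) ==> ((phi e).2 \in D)].

Definition upd phi e (p : V * V) e' := if e' == e then p else phi e'.

Lemma pair_graph_sym phi M : symmetric (pair_graph phi M).
Proof. by move=> x y; apply: eq_existsb => e; rewrite [(_ == (x, y)) || _]orbC. Qed.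

Lemma upd_id phi M e p e' : e \notin M -> e' \in M -> upd phi e p e' = phi e'.
Proof. by rewrite /upd => eM e'M; case: eqP => // ee; rewrite -ee e'M in eM. Qed.

Lemma pair_graph_updS phi M e p : e \notin M ->
  subrel (pair_graph phi M) (pair_graph (upd phi e p) (e |: M)).
Proof.
move=> eM x y /exists_inP [e' e'M h]; apply/exists_inP; exists e'.
  by rewrite inE e'M orbT.
by rewrite (upd_id _ _ eM).
Qed.

Lemma pair_graph_upd phi M e x y : pair_graph (upd phi e (x, y)) (e |: M) x y.
Proof. by apply/exists_inP; exists e; rewrite /upd ?setU11 ?eqxx. Qed.

Lemma own_upd phi M e x y v : e \notin M ->
  own (upd phi e (x, y)) (e |: M) v = own phi M v + (v == x).
Proof.
move=> eM; rewrite /own !card_set_sum (big_setU1 _ eM) /= {1}/upd eqxx /= addnC eq_sym.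
by congr addn; apply: eq_bigr => e' e'M; rewrite (upd_id _ _ eM).
Qed.

Lemma alive_upd phi M e x y A D : e \notin M ->
  alive (upd phi e (x, y)) (e |: M) A D = alive phi M A D && ((x \in A) ==> (y \in D)).
Proof.
move=> eM; apply/forall_inP/andP => [h|[/forall_inP h hxy] e'].
  split; last by have := h e (setU11 _ _); rewrite /upd eqxx.
  apply/forall_inP => e' e'M; have := h e' (setU1r _ e'M).
  by rewrite (upd_id _ _ eM).
by case/setU1P => [->|e'M]; [rewrite /upd eqxx | rewrite (upd_id _ _ eM) ?h].
Qed.

Lemma card_sum_own phi M : #|M| = \sum_v own phi M v.
Proof.
rewrite -sum1_card (partition_big (fun e => (phi e).1) xpredT) //=.
by apply: eq_bigr => v _; rewrite /own -sum1_card; apply: eq_bigl => e; rewrite inE.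
Qed.

(** If [A] had fewer than [2 * #|A|] outer neighbours, [A] with these neighbours could be padded to
    a set [D] of size [3 * #|A|], and [(A, D)] would be alive. *)
Lemma expander_of_alive phi M k0 : 3 * k0 <= n ->
  (forall A D, 0 < #|A| <= k0 -> #|D| = 3 * #|A| -> ~~ alive phi M A D) ->
  expander (pair_graph phi M) k0.
Proof.
move=> k0n dead A A0; rewrite leqNgt; apply/negP => small.
set N := outer_nbrs _ A in small.
have cAN : #|A :|: N| <= 3 * #|A|.
  by apply: leq_trans (leq_card_setU _ _) _; lia.
have [|D [sD _ cD]] := exists_card_between (m := 3 * #|A|) (subsetT (A :|: N)).
  by rewrite cAN cardsT card_ord; case/andP: A0 => _; lia.
have /negP := dead A D A0 cD; apply; apply/forall_inP => e eM; apply/implyP => e1.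
apply: (subsetP sD); rewrite inE; case e2 : (_ \in A) => //=.
rewrite inE e2 /=; apply/exists_inP; exists (phi e).1 => //.
by apply/exists_inP; exists e => //; rewrite -surjective_pairing eqxx.
Qed.

Lemma cycle_nth (e : rel V) s (d : V) i : cycle e s -> i < size s ->
  e (nth d s i) (nth d s (i.+1 %% size s)).
Proof.
case: s => [//|x s] /=; rewrite rcons_path => /andP [ps ls].
rewrite ltnS leq_eqVlt => /orP [/eqP ->|ilt].
  by rewrite modnn /= -last_nth.
rewrite modn_small ?ltnS //=; have /pathP - /(_ d i ilt) := ps.
by [].
Qed.

(** Each cycle edge is the pair of some hyperedge. Equal hyperedges have equal pairs, and for
    [n >= 3] distinct positions on the cycle give distinct pairs. *)
Lemma berge_of_hamiltonian phi M : 3 <= n ->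
  (forall e, e \in M -> (phi e).1 \in e /\ (phi e).2 \in e) ->
  hamiltonian (pair_graph phi M) -> has_berge_hamilton_cycle M.
Proof.
move=> n3 Mphi [s [us ss cs]]; rewrite card_ord in ss.
have d : V by exact: Ordinal (leq_trans (isT : 0 < 3) n3).
pose v (i : V) := nth d s i.
have vinj : injective v.
  by move=> i j /eqP; rewrite /v nth_uniq ?ss // => /eqP /val_inj.
have eP (i : V) : exists e,
    e \in M /\ (phi e = (v i, v (ordS i)) \/ phi e = (v (ordS i), v i)).
  have := @cycle_nth _ _ d i cs; rewrite ss ltn_ord => /(_ isT) /exists_inP [e eM].
  by case/orP => /eqP he; exists e; split=> //; [left|right].
have {eP} /choice [e eP] := eP.
have ordS_neq (i : V) : ordS (ordS i) <> i.
  move/(congr1 val) => /=; have := ltn_ord i; move: (nat_of_ord i) => j jn.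
  case: (ltnP j.+1 n) => h1; first rewrite (modn_small h1).
    case: (ltnP j.+2 n) => h2; first by rewrite modn_small //; lia.
    by have -> : j.+2 = n by [lia]; rewrite modnn; lia.
  have -> : j.+1 = n by lia.
  by rewrite modnn modn_small; lia.
exists v, e; split; first exact: injF_bij.
  move=> i j eij; have [_ hi] := eP i; have [_ hj] := eP j; rewrite eij in hi.
  case: hi hj => -> [] [] /vinj h1 /vinj h2 //.
  - by case: (ordS_neq j); congruence.
  - by case: (ordS_neq j); congruence.
move=> i; have [eM h] := eP i; split=> //; have [h1 h2] := Mphi _ eM.
by apply/subsetP => u; rewrite !inE => /orP [] /eqP ->; case: h h1 h2 => -> /=.
Qed.

Lemma berge_monotone M M' : M \subset M' ->
  has_berge_hamilton_cycle M -> has_berge_hamilton_cycle M'.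
Proof.
move=> MM [v [e [bv ie h]]]; exists v, e; split=> // i.
by have [eM ?] := h i; split=> //; exact: subsetP eM.
Qed.

End PairGraph.

(** * Building an expander, then adding boosters *)

Section MakerStrategy.
Import Order.TTheory GRing.Theory Num.Theory.
Variables (R : realFieldType) (n k b m q k0 : nat).
Notation V := 'I_n.
Notation X := (complete_hypergraph n k).
Notation Q := 'C(n - 2, k - 2).
Notation a := b.+1.
Hypothesis k1 : 1 < k.
Hypothesis n3 : 3 <= n.
Hypothesis m0 : 0 < m.
Hypothesis q0 : 0 < q.
Hypothesis k00 : 0 < k0.
Hypothesis k0n : 3 * k0 <= n.
(** In turn, the three numerical conditions say: a vertex with choices left keeps [q * Q] free
    edges; the initial potential is below 1; the edges claimed in [6 * n] rounds are too few to
    block [k0 * k0] boosters, each lying in [Q] edges. *)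
Hypothesis danger_small :
  ((k * a * 5)%:R + danger_cap R n k a m 1 + a%:R + (q * Q)%:R <= 'C(n.-1, k.-1)%:R :> R)%R.
Hypothesis pot_small : 9216 * n ^ 4 * k0 <= q ^ 5.
Hypothesis boosters_many : k * k * (a * (6 * n)) < k0 * k0 * Q.
Implicit Types (M U B : {set {set V}}) (phi : {set V} -> V * V) (e : {set V}).

Definition well_paired phi M U :=
  [/\ U \subset X, [disjoint M & U], #|X :\: U| <= a * #|M| &
      forall e, e \in M -> (phi e).1 \in e /\ (phi e).2 \in e].

Definition building_expander phi M U :=
  [/\ forall v, own phi M v <= 5, danger_inv R k a m 5 (X :\: U) (own phi M) &
      (pot R k0 q 5 (alive phi M) (own phi M) < 1)%R].

(** A round of this stage lengthens a longest path, so [l] pays for the rounds played; as [l <= n],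
    the stage lasts until round [6 * n] at most. *)
Definition adding_boosters phi M :=
  expander (pair_graph phi M) k0 /\
  exists2 l, has_path (pair_graph phi M) l & #|M| <= 5 * n + l.

Definition maker_inv M U :=
  has_berge_hamilton_cycle M \/
  exists2 phi, well_paired phi M U & building_expander phi M U \/ adding_boosters phi M.

Lemma claimed_move U e B : U \subset X -> e \in U -> B \subset U :\ e ->
  X :\: (U :\ e :\: B) = (X :\: U) :|: (e |: B).
Proof.
move=> UX eU BU; apply/setP => f; rewrite !(in_setD, in_setU, in_set1).
have [->|fe] /= := eqVneq f e; first by rewrite (subsetP UX) // eU andbF orbT.
have [fB|fB] /= := boolP (f \in B); last by rewrite orbF.
by have := subsetP BU _ fB; rewrite !inE fe /= orbT => /(subsetP UX); rewrite inE.
Qed.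

Lemma move_sub U e B : U \subset X -> e \in U -> B \subset U :\ e -> e |: B \subset X.
Proof.
move=> UX eU BU; rewrite subUset sub1set (subsetP UX) //=.
exact: subset_trans BU (subset_trans (subsetDl _ _) UX).
Qed.

Lemma move_card e B : #|B| <= b -> #|e |: B| <= a.
Proof. by move=> Bb; rewrite cardsU1 -add1n leq_add // leq_b1. Qed.

Lemma well_paired_move phi M U e x y B : well_paired phi M U -> e \in U ->
  x \in e -> y \in e -> B \subset U :\ e -> #|B| <= b ->
  well_paired (upd phi e (x, y)) (e |: M) (U :\ e :\: B).
Proof.
move=> [UX MU cU Mphi] eU xe ye BU Bb.
have eM : e \notin M by apply: contraL eU => eM; rewrite (disjointFr MU eM).
split.
- exact: subset_trans (subsetDl _ _) (subset_trans (subsetDl _ _) UX).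
- rewrite disjoint_sym disjoints_subset; apply/subsetP => f.
  by rewrite !inE negb_or => /and3P [_ -> fU]; rewrite (disjointFl MU fU).
- rewrite claimed_move // cardsU1 eM mulnDr muln1 addnC.
  apply: leq_trans (leq_card_setU _ _) _; apply: leq_add => //; exact: move_card.
- by move=> f /setU1P [->|fM]; [rewrite /upd eqxx | rewrite (upd_id _ _ eM) //; exact: Mphi].
Qed.

(** Maker serves the vertex [w] of largest danger. It still has [q * Q] free edges, and each partner
    accounts for at most [Q] of them, so [w] has at least [q] partners, enough for [pot_step]. *)
Lemma building_step phi M U v : well_paired phi M U -> building_expander phi M U ->
  own phi M v < 5 ->
  exists2 e, e \in U & forall B, B \subset U :\ e -> #|B| <= b ->
    maker_inv (e |: M) ((U :\ e) :\: B).
Proof.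
move=> wp [own5 dinv pot1] v5; have [UX MU cU Mphi] := wp.
(* The danger [deg - k * a * own], shifted by [k * a * 5] to stay a natural number. *)
pose dang u := deg (X :\: U) u + k * a * (5 - own phi M u).
have [w w5 wmax] := @arg_maxnP _ v (fun u => own phi M u < 5) dang v5.
have wmax' u : own phi M u < 5 ->
    deg (X :\: U) u + k * a * own phi M w <= deg (X :\: U) w + k * a * own phi M u.
  move=> u5; have := wmax u u5; rewrite /dang /geq /=.
  have := own5 u; have := own5 w; move: (own _ _ _) (own _ _ _) => ow ou h1 h2.
  have E1 : k * a * (5 - ou) + k * a * ou = k * a * 5 by rewrite -mulnDr subnK.
  have E2 : k * a * (5 - ow) + k * a * ow = k * a * 5 by rewrite -mulnDr subnK.
  lia.
pose Fr := [set u | u != w & [exists e in U, (w \in e) && (u \in e)]].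
have Frq : 0 < q <= #|Fr|.
  rewrite q0 /=.
  have degw : deg (X :\: U) w + q * Q <= 'C(n.-1, k.-1).
    rewrite -(ler_nat R) natrD; apply: le_trans danger_small.
    by rewrite lerD2r; exact: (danger_bound m0 w5 dinv).
  have split_deg : deg X w = deg (X :\: U) w + deg U w.
    rewrite /deg !card_set_sum [in LHS](big_setID U) /= addnC.
    by rewrite (setIidPr UX).
  have qU : q * Q <= deg U w.
    by rewrite deg_complete // ?(ltnW k1) in split_deg; lia.
  have Ule : deg U w <= #|Fr| * Q.
    rewrite -sum_nat_const.
    apply: (@leq_trans (\sum_(u in Fr) \sum_(e in U) ((w \in e) && (u \in e)))).
      rewrite exchange_big /= /deg card_set_sum; apply: leq_sum => e eU.
      case we : (w \in e) => //=; rewrite -card_set_sum card_gt0.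
      have : 1 < #|e| by have := subsetP UX _ eU; rewrite inE => /eqP ->.
      rewrite (cardsD1 w) we ltnS card_gt0 => /set0Pn [u]; rewrite !inE => /andP [uw ue].
      apply/set0Pn; exists u; rewrite !inE uw ue andbT /=.
      by apply/exists_inP; exists e; rewrite // we ue.
    apply: leq_sum => u; rewrite inE => /andP [uw _].
    rewrite eq_sym in uw; rewrite -card_set_sum -(codeg_complete k1 uw).
    apply: subset_leq_card; apply/subsetP => e; rewrite !inE => /andP [/(subsetP UX)].
    by rewrite inE => -> ->.
  have Q0 : 0 < Q by move: boosters_many; case: Q => //; rewrite muln0.
  by rewrite -(leq_pmul2r Q0); apply: leq_trans qU Ule.
have [u uFr pot_le] := @pot_step R V k0 q 5 (alive phi M) (own phi M) w Fr w5 Frq.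
move: uFr; rewrite inE => /andP [_ /exists_inP [e eU /andP [we ue]]].
exists e => // B BU Bb; right.
have eM : e \notin M by apply: contraL eU => eM; rewrite (disjointFr MU eM).
exists (upd phi e (w, u)); first exact: well_paired_move.
left; have ownE : own (upd phi e (w, u)) (e |: M) = (fun v => own phi M v + (v == w)).
  by apply/funext => v'; exact: own_upd.
split; rewrite ?ownE.
- move=> v' /=; have [->|_] := eqVneq v' w; first by rewrite addn1.
  by rewrite addn0.
- rewrite claimed_move //; apply: danger_step => //; first exact: subsetDl.
    exact: move_sub BU.
  exact: move_card.
- apply: le_lt_trans pot1; apply: le_trans pot_le; rewrite le_eqVlt; apply/orP; left.
  by apply/eqP; congr pot; apply/funext => A; apply/funext => D; exact: alive_upd.
Qed.

Lemma boosting_step phi M U : well_paired phi M U -> adding_boosters phi M ->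
  exists2 e, e \in U & forall B, B \subset U :\ e -> #|B| <= b ->
    maker_inv (e |: M) ((U :\ e) :\: B).
Proof.
move=> wp [expG [l0 l0P Ml0]]; have [UX MU cU Mphi] := wp.
set G := pair_graph phi M in expG l0P.
have path_le l : has_path G l -> l <= n.
  move=> [s /andP [us _] <-]; rewrite -[leqRHS](card_ord n) -(card_uniqP us).
  exact: max_card.
have [l lP lmax] : exists2 l, has_path G l & forall l', has_path G l' -> l' <= l.
  have ex : exists l, `[< has_path G l >] by exists l0; apply/asboolP.
  have [l /asboolP lP lmax] := @ex_maxnP _ n ex (fun l h => path_le l (asboolW h)).
  by exists l => // l' l'P; apply: lmax; apply/asboolP.
have V0 : 0 < #|V| by rewrite card_ord (leq_trans _ n3).
have longest s : gpath G s -> size s <= l by move=> gs; apply: lmax; exists s.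
have [Bst Bst_card BstP] :=
  boosters (@pair_graph_sym _ phi M) expG V0 k00 lP longest.
(* Otherwise all [Q] edges through each booster are claimed. Counting incidences the other way, a
   claimed edge contains at most [k * k] ordered pairs, contradicting [boosters_many]. *)
have [x [y [e [xyB eU xe ye]]]] :
    exists x y e, [/\ (x, y) \in Bst, e \in U, x \in e & y \in e].
  apply: contrapT => none; have := boosters_many; apply/negP; rewrite -leqNgt.
  apply: leq_trans (leq_mul Bst_card (leqnn Q)) _.
  rewrite -sum_nat_const.
  apply: (@leq_trans (\sum_(xy in Bst) \sum_(e in X :\: U) ((xy.1 \in e) && (xy.2 \in e)))).
    apply: leq_sum => -[x y] xyB /=; have [xy _] := BstP _ _ xyB.
    rewrite -card_set_sum -(codeg_complete k1 xy); apply: subset_leq_card.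
    apply/subsetP => e; rewrite !inE => /andP [-> /andP [xe ye]].
    rewrite xe ye !andbT; apply/negP => eU; apply: none.
    by exists x, y, e.
  rewrite exchange_big /=.
  apply: (@leq_trans (\sum_(e in X :\: U) k * k)).
    apply: leq_sum => e; rewrite !inE => /andP [_ /eqP <-].
    rewrite -cardsX -card_set_sum; apply: subset_leq_card.
    by apply/subsetP => -[x y]; rewrite !inE => /andP [_].
  rewrite sum_nat_const mulnC leq_mul2l; apply/orP; right.
  apply: leq_trans cU _; rewrite leq_mul2l; apply/orP; right.
  by have := path_le _ l0P; lia.
exists e => // B BU Bb.
have eM : e \notin M by apply: contraL eU => eM; rewrite (disjointFr MU eM).
have [_ boost] := BstP _ _ xyB.
have wp' := well_paired_move wp eU xe ye BU Bb.
case: (boost (pair_graph (upd phi e (x, y)) (e |: M))) => [||//|ham|longer].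
- exact: pair_graph_sym.
- exact: pair_graph_updS.
- exact: pair_graph_upd.
- by left; have [_ _ _ h] := wp'; exact: berge_of_hamiltonian n3 h ham.
right; exists (upd phi e (x, y)) => //; right; split.
  by apply: (@expanderS _ G) => // u v; exact: pair_graph_updS.
exists l.+1 => //; rewrite cardsU1 eM add1n addnS ltnS.
by apply: leq_trans Ml0 _; rewrite leq_add2l lmax.
Qed.

(** Once every vertex has made 5 choices, the small potential forces expansion and [#|M| <= 5 * n];
    the second stage then starts from a one-vertex path. *)
Lemma maker_inv_step M U : maker_inv M U ->
  has_berge_hamilton_cycle M \/
  exists2 e, e \in U & forall B, B \subset U :\ e -> #|B| <= b ->
    maker_inv (e |: M) ((U :\ e) :\: B).
Proof.
case=> [|[phi wp st]]; [by left | right].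
case: st => [bu|]; last exact: boosting_step.
have [[v v5]|sat] := pselect (exists v, own phi M v < 5); first exact: building_step bu v5.
have {}sat v : 5 <= own phi M v by rewrite leqNgt; apply/negP => h; apply: sat; exists v.
have [own5 _ pot1] := bu.
apply: (boosting_step wp); split.
  by apply: expander_of_alive => // A D; exact: pot_all_dead pot1 sat A D.
have d : V by exact: Ordinal (leq_trans (isT : 0 < 3) n3).
exists 1; first by exists [:: d].
rewrite (card_sum_own phi); apply: leq_trans (leq_addr _ _).
apply: leq_trans (leq_sum _ (fun v _ => own5 v)) _.
by rewrite sum_nat_const card_ord mulnC.
Qed.

Lemma maker_wins_of_bounds : maker_wins_berge n k b.
Proof.
apply: (@maker_wins_invariant _ X b set0 _ maker_inv).
- have d : V by exact: Ordinal (leq_trans (isT : 0 < 3) n3).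
  pose phi (e : {set V}) := (d, d).
  right; exists phi; first split.
  + exact: subxx.
  + by rewrite -setI_eq0 set0I.
  + by rewrite setDv cards0.
  + by move=> e; rewrite inE.
  have own0 : own phi set0 = (fun=> 0).
    by apply/funext => v; apply: eq_card0 => e; rewrite !inE.
  left; split; rewrite ?own0 //.
  + by rewrite setDv; exact: danger_inv0.
  + have -> : alive phi set0 = (fun _ _ => true).
      apply/funext => A; apply/funext => D; apply/forall_inP => e.
      by rewrite inE.
    by apply: pot_init => //; rewrite card_ord.
- move=> M U inv /set0Pn [e0 e0U].
  have [ham|//] := maker_inv_step inv; exists e0 => // B _ _.
  by left; apply: berge_monotone ham; exact: subsetUr.
(* On an exhausted board there is no next edge, so only the cycle is left. *)
- by move=> M /maker_inv_step [//|[e]]; rewrite inE.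
Qed.

End MakerStrategy.

(** * Breaker's strategy *)

Section BreakerStrategy.
Variables (n k b a0 a1 : nat).
Notation V := 'I_n.
Notation X := (complete_hypergraph n k).
Notation Q := 'C(n - 2, k - 2).
Hypothesis k1 : 1 < k.
Hypothesis a0n : a0 <= n.
Hypothesis a1_gt0 : 0 < a1.
Hypothesis b_gt0 : 0 < b.
(** The first phase has at most [a0 * a0 * Q %/ b + 1] rounds, each touching at most [k] vertices,
    and must spare [a1] of them. Then [box_sum] makes the levelling reach zero when one box is
    left. *)
Hypothesis phase1_short : k * (a0 * a0 * Q %/ b).+1 + a1 <= a0.
Hypothesis box_sum : 'C(n.-1, k.-1) <= \sum_(1 <= i < a1) b %/ i.
Implicit Types (M U B : {set {set V}}) (A : {set V}) (e : {set V}) (u v w : V).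

Definition untouched M A := forall e, e \in M -> e :&: A = set0.

Definition overlapping A := [set e in X | 1 < #|e :&: A|].

(* The degree to which every box has been reduced when [j] boxes are left. *)
Definition box_cap j := 'C(n.-1, k.-1) - \sum_(j <= i < a1) b %/ i.

(** [r] counts the rounds played: each costs [A] at most [k] vertices and disposes of at least [b]
    overlapping edges. *)
Definition clearing A0 M U := exists2 A : {set V}, A \subset A0 & exists r,
  [/\ untouched M A, a0 <= #|A| + k * r &
      #|overlapping A0 :&: U| + b * r <= a0 * a0 * Q].

(** The free edges at the vertices of [A] form the boxes; they are disjoint because no free edge
    meets [A] twice. *)
Definition emptying M U := exists A : {set V},
  [/\ untouched M A, 0 < #|A| <= a1, forall e, e \in U -> #|e :&: A| <= 1 &
      forall v, v \in A -> deg U v <= box_cap #|A|].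

Definition breaker_inv A0 M U := U \subset X /\ (clearing A0 M U \/ emptying M U).

Lemma card_overlapping A : #|overlapping A| <= #|A| * #|A| * Q.
Proof.
rewrite -cardsX -sum_nat_const.
apply: (@leq_trans (\sum_(uv in setX A A)
  \sum_(e in X) [&& uv.1 != uv.2, uv.1 \in e & uv.2 \in e])); last first.
  apply: leq_sum => -[u v] _ /=; have [_|uv] := eqVneq u v; first by rewrite big1.
  rewrite -card_set_sum -(codeg_complete k1 uv); apply: subset_leq_card.
  by apply/subsetP => e; rewrite !inE.
rewrite exchange_big /overlapping card_set_sum /=; apply: leq_sum => e _.
case: ltnP => // /card_gt1P [u [v]]; rewrite !inE.
move=> [/andP [ue uA] /andP [ve vA] uv]; rewrite -card_set_sum card_gt0.
by apply/set0Pn; exists (u, v); rewrite !inE uA vA /= uv ue ve.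
Qed.

Lemma untouched_move M A x : untouched M A -> untouched (x |: M) (A :\: x).
Proof.
move=> MA e; case/setU1P => [->|/MA eA]; apply/setP => v.
  by rewrite !inE; case: (v \in x).
by have /setP /(_ v) := eA; rewrite !inE; case: (v \in e) => //= ->; rewrite andbF.
Qed.

Lemma untouchedS M A A' : A' \subset A -> untouched M A -> untouched M A'.
Proof.
move=> AA MA e /MA eA; apply/eqP; rewrite -subset0 -eA; exact: setIS.
Qed.

Lemma box_capS j : 0 < j -> box_cap j.+1 <= box_cap j + b %/ j.
Proof.
rewrite /box_cap => j0; have [ja|ja] := ltnP j a1; last by rewrite !big_geq ?leq_addr // ltnW.
rewrite [in leqRHS]big_ltn //.
move: (b %/ j) (\sum_(j.+1 <= i < a1) b %/ i) 'C(_, _) => c s d; lia.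
Qed.

Lemma start_emptying M U A : U \subset X -> untouched M A -> a1 <= #|A| ->
  (forall e, e \in U -> #|e :&: A| <= 1) -> emptying M U.
Proof.
move=> UX MA Aa1 UA; have [A' A'A cA'] := exists_subset_card Aa1.
exists A'; split; first exact: untouchedS MA.
- by rewrite cA' a1_gt0 leqnn.
- move=> e /UA; apply: leq_trans; apply: subset_leq_card; exact: setIS.
move=> v _; rewrite cA' /box_cap big_geq // subn0 -(deg_complete v) ?(ltnW k1) //.
exact: deg_sub.
Qed.

(** While more than [b] overlapping edges are free, Breaker takes [b] of them; when at most [b]
    remain he takes them all and the boxes are ready. *)
Lemma clearing_step A0 M U x : U \subset X -> clearing A0 M U -> x \in U ->
  exists B0, [/\ B0 \subset U :\ x, #|B0| <= b &
    forall B, B0 \subset B -> B \subset U :\ x ->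
      clearing A0 (x |: M) ((U :\ x) :\: B) \/ emptying (x |: M) ((U :\ x) :\: B)].
Proof.
move=> UX [A AA0 [r [MA cA cK]]] xU; set K := overlapping A0 :&: (U :\ x).
have cAx : a0 <= #|A :\: x| + k * r.+1.
  have : #|x :&: A| <= k.
    have := subsetP UX _ xU; rewrite inE => /eqP <-; exact: subset_leq_card (subsetIl _ _).
  by have := cardsID x A; rewrite setIC mulnS; lia.
have [Kb|bK] := leqP #|K| b.
  exists K; split=> //; first exact: subsetIr.
  move=> B KB BU; right; apply: (@start_emptying _ _ (A :\: x)).
  - exact: subset_trans (subsetDl _ _) (subset_trans (subsetDl _ _) UX).
  - exact: untouched_move.
  - have : r <= a0 * a0 * Q %/ b by rewrite leq_divRL // mulnC; lia.
    by move=> rE; have := leq_mul (leqnn k) (rE : r.+1 <= _.+1); lia.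
  move=> e; rewrite in_setD => /andP [eB eU]; rewrite leqNgt; apply: contra eB => e1.
  apply: (subsetP KB); rewrite in_setI eU andbT inE.
  have -> : e \in X by apply: (subsetP UX); exact: (subsetP (subsetDl _ _) _ eU).
  apply: leq_trans e1 _; apply: subset_leq_card; apply: setIS.
  exact: subset_trans (subsetDl _ _) AA0.
have [B0 B0K cB0] := exists_subset_card (ltnW bK).
exists B0; split; rewrite ?cB0 //; first exact: subset_trans B0K (subsetIr _ _).
move=> B B0B BU; left; exists (A :\: x); first exact: subset_trans (subsetDl _ _) AA0.
exists r.+1; split=> //; first exact: untouched_move.
have : #|overlapping A0 :&: (U :\ x :\: B)| + b <= #|overlapping A0 :&: U|.
  rewrite -cB0 -cardsUI (_ : _ :&: B0 = set0) ?cards0 ?addn0.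
    apply: subset_leq_card; rewrite subUset; apply/andP; split.
      by apply: setIS; apply: subset_trans (subsetDl _ _) (subsetDl _ _).
    by apply: subset_trans B0K _; apply: setIS; exact: subsetDl.
  apply/setP => e; rewrite !inE; case: (boolP (e \in B0)) => [/(subsetP B0B) ->|];
    by rewrite ?andbF.
by rewrite mulnS; lia.
Qed.

(** A last box is already empty because [box_cap 1 = 0], so Maker cannot touch its vertex. With more
    boxes, Maker's edge spoils at most one; Breaker discards one box and lowers each of the others
    to the next cap. *)
Lemma emptying_step M U x : emptying M U -> x \in U ->
  exists B0, [/\ B0 \subset U :\ x, #|B0| <= b &
    forall B, B0 \subset B -> B \subset U :\ x -> emptying (x |: M) ((U :\ x) :\: B)].
Proof.
move=> [A [MA /andP [A0 Aa1] UA degA]] xU.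
have [A1|A1] := leqP #|A| 1.
  have cA : #|A| = 1 by apply/eqP; rewrite eqn_leq A1.
  have /eqP/cards1P [v defA] := cA.
  have vA : v \in A by rewrite defA set11.
  have /eqP deg0 : deg U v == 0.
    rewrite -leqn0; apply: leq_trans (degA v vA) _.
    by rewrite cA leqn0 subn_eq0.
  have Uv e : e \in U -> v \notin e.
    move=> eU; apply/negP => ve; have : e \in [set e in U | v \in e] by rewrite inE eU.
    by rewrite (cards0_eq deg0) inE.
  exists set0; split; rewrite ?sub0set ?cards0 // => B _ _.
  exists A; split.
  - move=> e /setU1P [->|]; last exact: MA.
    apply/setP => u; rewrite defA !inE; case: eqP => [->|]; rewrite ?andbF //.
    by rewrite (negPf (Uv _ xU)).
  - by rewrite A0.
  - by move=> e; rewrite !inE => /and3P [_ _ /UA].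
  move=> u uA; apply: leq_trans (degA u uA); apply: deg_sub.
  exact: subset_trans (subsetDl _ _) (subsetDl _ _).
have [A' A'A cA'] : exists2 A' : {set V}, A' \subset A :\: x & #|A'| = #|A|.-1.
  apply: exists_subset_card; have := cardsID x A; have := UA x xU.
  by rewrite setIC; lia.
have A'A0 : A' \subset A by apply: subset_trans A'A (subsetDl _ _).
set d := box_cap #|A'|.
have /choice [S SP] : forall v, exists S : {set {set V}}, v \in A' ->
    [/\ S \subset [set e in U :\ x | v \in e], #|S| <= b %/ #|A'| &
        #|[set e in U :\ x | v \in e]| <= d + #|S|].
  move=> v; have [vA'|_] := boolP (v \in A'); last by exists set0.
  (* [S] consists of exactly the excess over the cap [d], none if the box is already low enough. *)
  have [S SU cS] := exists_subset_card (leq_subr d #|[set e in U :\ x | v \in e]|).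
  exists S => _; split=> //; rewrite cS; last by rewrite -leq_subLR.
  rewrite leq_subLR; apply: leq_trans (_ : deg U v <= _).
    by apply: deg_sub; exact: subsetDl.
  apply: leq_trans (degA v (subsetP A'A0 _ vA')) _.
  have <- : #|A'|.+1 = #|A| by rewrite cA' prednK.
  by apply: box_capS; rewrite cA'; lia.
exists (\bigcup_(v in A') S v); split.
- apply/bigcupsP => v /SP [Sv _ _]; apply: subset_trans Sv _.
  by apply/subsetP => e; rewrite inE => /andP [].
- apply: leq_trans (leq_trans _ (leq_trunc_div b #|A'|)); last first.
    by rewrite mulnC -sum_nat_const; apply: leq_sum => v /SP [_ Sv _]; exact: Sv.
  elim/big_ind2: _ => [|m1 B1 m2 B2 h1 h2|//]; rewrite ?cards0 //.
  by apply: leq_trans (leq_card_setU _ _) _; exact: leq_add.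
move=> B SB BU; exists A'; split.
- by apply: (untouchedS A'A); exact: untouched_move.
- by rewrite cA'; lia.
- move=> e; rewrite !inE => /and3P [_ _ /UA]; apply: leq_trans.
  by apply: subset_leq_card; apply: setIS.
move=> v vA'; have [Sv _ cSv] := SP v vA'.
have : deg (U :\ x :\: B) v + #|S v| <= #|[set e in U :\ x | v \in e]|.
  rewrite -cardsUI (_ : _ :&: S v = set0) ?cards0 ?addn0.
    apply: subset_leq_card; rewrite subUset Sv andbT; apply/subsetP => e.
    by rewrite !inE => /andP [/andP [_ ->]].
  apply/setP => e; rewrite !inE; case: (boolP (e \in S v)) => [eS|]; last by rewrite andbF.
  have -> : e \in B by apply: (subsetP SB); apply/bigcupP; exists v.
  by [].
by rewrite -/d; lia.
Qed.

Lemma breaker_wins_of_bounds : breaker_wins_berge n k b.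
Proof.
have [A0 _ cA0] : exists2 A0 : {set V}, A0 \subset [set: V] & #|A0| = a0.
  by apply: exists_subset_card; rewrite cardsT card_ord.
apply: (@breaker_wins_invariant _ X b _ (breaker_inv A0)).
- split; first exact: subxx.
  left; exists A0; first exact: subxx.
  exists 0; split; first by move=> e; rewrite inE.
    by rewrite cA0 muln0 addn0.
  rewrite muln0 addn0 -cA0; apply: leq_trans (card_overlapping A0).
  exact: subset_leq_card (subsetIl _ _).
- move=> M U x [UX inv] xU.
  have U'X B : U :\ x :\: B \subset X.
    exact: subset_trans (subsetDl _ _) (subset_trans (subsetDl _ _) UX).
  case: inv => [cl|em].
    have [B0 [h1 h2 h3]] := clearing_step UX cl xU.
    by exists B0; split=> // B BB BU; split; last exact: h3.
  have [B0 [h1 h2 h3]] := emptying_step em xU.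
  by exists B0; split=> // B BB BU; split=> //; right; exact: h3.
move=> M [_ inv] [f [e [[g fg gf] _ h]]].
have [v vM] : exists v : V, forall e, e \in M -> v \notin e.
  have [A [AM]] : exists A, untouched M A /\ 0 < #|A|.
    (* Even if the board runs out during the clearing phase, [phase1_short] leaves an untouched
       vertex. *)
    case: inv => [[A _ [r [MA cA cK]]]|[A [MA /andP [A1 _] _ _]]]; exists A => //.
    split=> //; have : r <= a0 * a0 * Q %/ b by rewrite leq_divRL // mulnC; lia.
    by move=> rE; have := leq_mul (leqnn k) (rE : r.+1 <= _.+1); lia.
  case/card_gt0P => v vA; exists v => e' /AM e'A; apply/negP => ve.
  by have /setP /(_ v) := e'A; rewrite !inE ve vA.
have [eM /subsetP /(_ v)] := h (g v); rewrite !inE gf eqxx => /(_ isT).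
by apply/negP; exact: vM.
Qed.

End BreakerStrategy.

(** * Asymptotics *)

Import Order.TTheory GRing.Theory Num.Theory.
Import numFieldNormedType.Exports.
Local Open Scope ring_scope.

(** * Logarithms and harmonic sums *)

Section LogarithmBounds.
Variable R : realType.
Implicit Types (x c T : R) (i n : nat).

(** A linear bound of arbitrarily small slope; applied to [ln n], it makes [ln (ln n)] a small
    fraction of [ln n]. *)
Lemma ln_le_div x c : 0 < x -> 0 < c -> ln x <= x / c + ln c.
Proof.
move=> x0 c0; rewrite -lerBlDr -ln_div ?posrE //.
by apply/ltW/ln_sublinear/divr_gt0.
Qed.

Lemma ln_incr_ge i : (0 < i)%N -> i.+1%:R^-1 <= ln i.+1%:R - ln i%:R :> R.
Proof.
move=> i0; have i0R : 0 < i%:R :> R by rewrite ltr0n.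
have S0 : 0 < i.+1%:R :> R by rewrite ltr0n.
rewrite -lerN2 opprB -ln_div ?posrE //.
have -> : i%:R / i.+1%:R = 1 + - i.+1%:R^-1 :> R.
  by rewrite -(natr1 i) in S0 *; field; rewrite gt_eqF.
apply: le_ln1Dx; rewrite ltrN2 invf_lt1 //.
by rewrite -[1]/(1%:R) ltr_nat ltnS.
Qed.

Lemma ln_incr_le i : (0 < i)%N -> ln i.+1%:R - ln i%:R <= i%:R^-1 :> R.
Proof.
move=> i0; have i0R : 0 < i%:R :> R by rewrite ltr0n.
rewrite -ln_div ?posrE ?ltr0n //.
have -> : i.+1%:R / i%:R = 1 + i%:R^-1 :> R.
  by rewrite -natr1; field; rewrite gt_eqF.
by apply: le_ln1Dx; apply: lt_trans (_ : 0 < _); rewrite ?invr_gt0 // oppr_lt0.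
Qed.

(** The terms below [m] give a harmonic sum and at most [m] codegrees. Beyond [m] each term is at
    most [k * a / m], so with [m] linear in [n] the tail is only a constant times [a]. *)
Lemma danger_cap_le n k a m : (0 < n)%N -> (0 < m)%N ->
  danger_cap R n k a m 1 <=
  a%:R * ln n%:R + m%:R * 'C(n - 2, k - 2)%:R + n%:R * ((k * a)%:R / m%:R).
Proof.
move=> n0 m0; rewrite /danger_cap /danger_incr; move: 'C(n - 2, k - 2) => Q.
have m0R : 0 < m%:R :> R by rewrite ltr0n.
suff : \sum_(1 <= i < n) (if (i < m)%N then a%:R / i.+1%:R + Q%:R
                         else (k * a)%:R / i.+1%:R) <=
  a%:R * ln n%:R + (minn n m)%:R * Q%:R + n%:R * ((k * a)%:R / m%:R) :> R.
  move=> h; apply: le_trans h _; rewrite lerD2r lerD2l ler_wpM2r // ler_nat.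
  exact: geq_minr.
have ka0 : 0 <= (k * a)%:R / m%:R :> R by rewrite divr_ge0.
case: n n0 => // n _; elim: n => [|n IH].
  by rewrite big_geq // ln1 mulr0 add0r mul1r addr_ge0 // mulr_ge0.
rewrite big_nat_recr //=; move: (\sum_(1 <= i < n.+1) _) IH => S IH.
have arith1 (s A l1 l2 w' Q' z y x : R) : s <= A * l2 + w' * Q' + z * y ->
    A * x <= A * (l1 - l2) -> 0 <= y ->
    s + (A * x + Q') <= A * l1 + (w' + 1) * Q' + (z + 1) * y by move=> *; lra.
have arith2 (s A l1 l2 w' Q' z y y' x : R) : s <= A * l2 + w' * Q' + z * y ->
    A * x <= A * (l1 - l2) -> 0 <= A * x -> y' <= y ->
    s + y' <= A * l1 + (w' + 0) * Q' + (z + 1) * y by move=> *; lra.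
have h1 := @ln_incr_ge n.+1 isT.
have a0 : 0 <= a%:R :> R by [].
have {}h1 : a%:R / n.+2%:R <= a%:R * (ln n.+2%:R - ln n.+1%:R) :> R.
  exact: ler_wpM2l a0 _ _ h1.
have e : (minn n.+2 m)%:R = (minn n.+1 m)%:R + (n.+1 < m)%N%:R :> R.
  by rewrite -natrD; congr _%:R; case: ltnP => /=; lia.
rewrite {}e; move: (minn n.+1 m) IH => w IH; rewrite -[n.+2%:R in X in _ <= _ + X]natr1.
case: ltnP => nm /=; rewrite ?mulr1n ?mulr0n.
  exact: arith1 IH h1 ka0.
have h2 : (k * a)%:R / n.+2%:R <= (k * a)%:R / m%:R :> R.
  by rewrite ler_wpM2l // lef_pV2 ?posrE ?ltr0n // ler_nat; lia.
have h3 : 0 <= a%:R / n.+2%:R :> R by rewrite divr_ge0.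
exact: arith2 IH h1 h3 h2.
Qed.

(** Rounding each quotient down loses less than 1, hence the loss [m]. *)
Lemma sum_div_ge b m : (0 < m)%N ->
  b%:R * ln m%:R - m%:R <= (\sum_(1 <= i < m) b %/ i)%N%:R :> R.
Proof.
case: m => // m _; elim: m => [|m IH].
  by rewrite big_geq // ln1 mulr0 sub0r oppr_le0.
rewrite big_nat_recr //= natrD.
have h1 := @ln_incr_le m.+1 isT.
have b0 : 0 <= b%:R :> R by [].
have {}h1 : b%:R * (ln m.+2%:R - ln m.+1%:R) <= b%:R / m.+1%:R :> R.
  exact: ler_wpM2l b0 _ _ h1.
have h2 : b%:R / m.+1%:R <= (b %/ m.+1)%:R + 1 :> R.
  by rewrite ler_pdivrMr ?ltr0n // natr1 -natrM ler_nat ltnW // ltn_ceil.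
have arith (S B l1 l2 z y x : R) : B * l2 - z <= S -> B * (l1 - l2) <= y ->
    y <= x + 1 -> B * l1 - (z + 1) <= S + x by move=> *; lra.
by rewrite -[m.+2%:R in X in _ - X]natr1; exact: arith IH h1 h2.
Qed.

Lemma ln_large T : exists n0 : nat, forall n, (n0 <= n)%N -> T <= ln n%:R.
Proof.
exists (Num.truncn (expR T)).+1 => n hn; rewrite -(expRK T).
have h : expR T <= n%:R.
  by apply: le_trans (ltW (truncnS_gt _)) _; rewrite ler_nat.
by rewrite ler_ln ?posrE ?expR_gt0 // (lt_le_trans (expR_gt0 T)).
Qed.

Lemma ln_small_linear c T : 0 < c ->
  exists n0 : nat, forall n, (n0 <= n)%N -> T + ln n%:R <= c * n%:R.
Proof.
move=> c0; set d := 2 / c; have d0 : 0 < d by rewrite divr_gt0.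
(* Half of [c * n] pays for the growth of [ln n], the other half for the constant [T + ln d]. *)
exists (Num.truncn (`|(T + ln d) * d|)).+1 => n hn.
have h : (T + ln d) * d <= n%:R.
  apply: le_trans (ler_norm _) _; apply: le_trans (ltW (truncnS_gt _)) _.
  by rewrite ler_nat.
have n0 : 0 < n%:R :> R by rewrite ltr0n; lia.
have := ln_le_div n0 d0.
have h2 : T + ln d <= n%:R / d by rewrite ler_pdivlMr.
have e : n%:R / d = n%:R * c / 2 by rewrite /d invf_div mulrA.
rewrite e in h2 *; lra.
Qed.

End LogarithmBounds.

(** * Numerical inequalities for both strategies *)

Section RealInequalities.
Variable R : realFieldType.
Implicit Types (x y n k D Q N L b a q H K G eps : R).

(** Throughout, [D] is the degree, [Q] the codegree, [N] the normalising binomial and [L] is [ln n].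
    Replacing [N] by [D] and [b] by [b + 1] costs [eps / 4] each. *)
Lemma bias_bound eps n k D Q N L b : 0 < eps <= 1 -> 2 <= k -> 8 * k <= n * eps ->
  1 <= Q -> 0 <= N -> 0 <= L -> 0 <= b ->
  (k - 1) * D = (n - 1) * Q -> n * D = (n - k + 1) * N ->
  (k - 1) * L <= eps / 4 * (n - 1) -> b * L <= (1 - eps) * N ->
  (b + 1) * L <= (1 - eps / 2) * D.
Proof.
move=> /andP [e0 e1] k2 kn Q1 N0 L0 b0 hD hN hL hb.
have n1 : 0 <= n - 1 by nra.
have D0 : 0 <= D.
  rewrite -(@pmulr_rge0 _ (k - 1)) ?hD; last by lra.
  by rewrite mulr_ge0 //; lra.
have LD : L <= eps / 4 * D.
  rewrite -(@ler_pM2l _ (k - 1)); last by lra.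
  apply: le_trans hL _; rewrite mulrCA hD.
  by rewrite ler_wpM2l //; [lra | nra].
have ND : N <= (1 + eps / 4) * D.
  have d0 : 0 < n - k + 1 by nra.
  rewrite -(@ler_pM2l _ (n - k + 1)) // -hN.
  have ke : (k - 1) * eps <= (k - 1) * 1 by rewrite ler_wpM2l //; lra.
  by rewrite mulrA ler_wpM2r //; lra.
have : (1 - eps) * N <= (1 - eps) * ((1 + eps / 4) * D) by rewrite ler_wpM2l //; lra.
have h1 : 0 <= eps * eps * D by rewrite !mulr_ge0 // ltW.
have h2 : 0 <= eps * D by rewrite !mulr_ge0 // ltW.
lra.
Qed.

(** The main term [a * L] spares [eps / 2 * D]; the other multiples of [a] and the two copies of
    [q * Q] take at most [eps / 8 * D] each. *)
Lemma danger_bound_arith eps n k D Q L a q H : 0 < eps <= 1 -> 2 <= k -> 2 <= n ->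
  0 <= Q -> 0 <= D -> 0 <= a -> 0 < q -> 0 <= H ->
  (k - 1) * D = (n - 1) * Q -> a * L <= (1 - eps / 2) * D ->
  q * H <= n -> n <= 2 * H * q -> 32 * k <= eps * H ->
  8 * (5 * k + 1 + 2 * H * k) <= eps * L ->
  k * a * 5 + (a * L + q * Q + n * (k * a / q)) + a + q * Q <= D.
Proof.
move=> /andP [e0 e1] k2 n2 Q0 D0 a0 q0 H0 hD aL qH nH kH KL.
have h1 : n * (k * a / q) <= 2 * H * (k * a).
  rewrite mulrA ler_pdivrMr // [leRHS]mulrAC ler_wpM2r //.
  by rewrite mulr_ge0 //; lra.
have h2 : 8 * (a * (5 * k + 1 + 2 * H * k)) <= eps * D.
  have : a * (8 * (5 * k + 1 + 2 * H * k)) <= a * (eps * L) by rewrite ler_wpM2l.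
  have : eps * (a * L) <= eps * ((1 - eps / 2) * D) by rewrite ler_wpM2l // ltW.
  have : 0 <= eps * (eps / 2 * D) by rewrite !mulr_ge0 //; lra.
  lra.
have h3 : 16 * (q * Q) <= eps * D.
  rewrite -(@ler_pM2l _ (k - 1)); last by lra.
  have -> : (k - 1) * (eps * D) = eps * (n - 1) * Q by rewrite mulrCA hD mulrA.
  rewrite mulrA mulrA ler_wpM2r //.
  have g1 : q * (32 * k) <= q * (eps * H) by rewrite ler_wpM2l // ltW.
  have g2 : eps * (q * H) <= eps * n by rewrite ler_wpM2l // ltW.
  have g3 : eps * n <= eps * (2 * (n - 1)) by rewrite ler_wpM2l //; lra.
  lra.
have h4 : 0 <= eps * D by rewrite mulr_ge0 // ltW.
lra.
Qed.

(** As [a] is at most [n * Q / L], the left side has order [n * n * Q / L], against order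
    [n * n * Q] on the right; a large [L] decides. *)
Lemma booster_bound_arith n k D Q L a k0 G : 2 <= k -> 1 <= n -> 1 <= Q -> 0 < k0 ->
  0 < a -> 0 < L -> (k - 1) * D = (n - 1) * Q -> a * L <= D ->
  n <= G * k0 -> 6 * (k * k) * (G * G) < L ->
  k * k * (a * (6 * n)) < k0 * k0 * Q.
Proof.
move=> k2 n1 Q1 k0P a0 L0 hD aL nG GL.
have Q0 : 0 < Q by lra.
have D0 : 0 <= D by apply: le_trans aL; rewrite mulr_ge0 // ltW.
have DnQ : D <= n * Q.
  have : 0 <= (k - 2) * D by rewrite mulr_ge0 //; lra.
  lra.
rewrite -(@ltr_pM2r _ L) //.
have s1 : k * k * (a * (6 * n)) * L <= 6 * (k * k) * (n * n) * Q.
  have : 6 * (k * k) * n * (a * L) <= 6 * (k * k) * n * (n * Q).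
    by rewrite ler_wpM2l ?mulr_ge0 //; lra.
  lra.
have s2 : n * n <= (G * k0) * (G * k0) by rewrite ler_pM //; lra.
have s3 : 6 * (k * k) * (n * n) * Q <= 6 * (k * k) * ((G * k0) * (G * k0)) * Q.
  by rewrite ler_wpM2r ?(ltW Q0) // ler_wpM2l // !mulr_ge0 //; lra.
have s4 : 6 * (k * k) * (G * G) * (k0 * k0 * Q) < L * (k0 * k0 * Q).
  by rewrite ltr_pM2r // !mulr_gt0.
lra.
Qed.

(* [a0] is about [n / (8 k^2 L)] and [E] bounds the length of the first phase. *)
Lemma clearing_bound_arith n k D Q L b a0 a1 E : 2 <= k -> 2 <= n -> 0 < Q -> 0 < L ->
  0 <= E -> 0 <= a0 -> (k - 1) * D = (n - 1) * Q -> D <= b * L ->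
  E * b <= a0 * a0 * Q -> a0 * (8 * (k * k) * L) <= n -> 4 * k <= a0 ->
  2 * a1 <= a0 -> k * (E + 1) + a1 <= a0.
Proof.
move=> k2 n2 Q0 L0 E0 a00 hD bL Eb a0n ka0 a1a0.
have s1 : E * (n - 1) <= a0 * a0 * L * (k - 1).
  rewrite -(ler_pM2r Q0).
  have t1 : E * ((k - 1) * D) <= E * ((k - 1) * (b * L)).
    by rewrite ler_wpM2l // ler_wpM2l //; lra.
  have t2 : (E * b) * (L * (k - 1)) <= (a0 * a0 * Q) * (L * (k - 1)).
    by rewrite ler_wpM2r // mulr_ge0 //; lra.
  rewrite hD in t1; lra.
have s2 : a0 * (a0 * (8 * (k * k) * L)) <= a0 * (2 * (n - 1)).
  by rewrite ler_wpM2l //; lra.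
have s3 : k * E * 4 <= a0.
  rewrite -(@ler_pM2r _ (n - 1)); last by lra.
  have t1 : 4 * k * (E * (n - 1)) <= 4 * k * (a0 * a0 * L * (k - 1)).
    by rewrite ler_wpM2l //; lra.
  have t2 : 0 <= a0 * a0 * L * k by rewrite !mulr_ge0 //; lra.
  lra.
lra.
Qed.

(** Here [l] is [ln a1]. The product [b * l] is at least [(1 + eps / 2) * D], and the rounding loss
    [a1] is at most [eps / 2 * D]. *)
Lemma box_bound_arith eps n k D Q L l b a1 : 0 < eps <= 1 -> 2 <= k -> 2 <= n ->
  1 <= Q -> 0 <= b -> (k - 1) * D = (n - 1) * Q -> (1 + eps) * D <= b * L ->
  a1 * (8 * (k * k) * L) <= n -> 0 <= a1 -> 1 <= eps * L -> (1 - eps / 4) * L <= l ->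
  D <= b * l - a1.
Proof.
move=> /andP [e0 e1] k2 n2 Q1 b0 hD bL a1n a10 eL Ll.
have D0 : n <= 2 * k * D.
  have t1 : (n - 1) * 1 <= (n - 1) * Q by rewrite ler_wpM2l //; lra.
  have t2 : 0 <= (k - 1) * D by rewrite hD mulr_ge0 //; lra.
  have t3 : 0 <= D by rewrite -(@pmulr_rge0 _ (k - 1)) //; lra.
  lra.
have Dpos : 0 <= D by rewrite -(@pmulr_rge0 _ (2 * k)) //; lra.
have a1D : 2 * a1 <= eps * D.
  rewrite -(@ler_pM2r _ (2 * k)); last by lra.
  have t1 : a1 * (8 * (k * k)) * 1 <= a1 * (8 * (k * k)) * (eps * L).
    by rewrite ler_wpM2l // !mulr_ge0 //; lra.
  have t2 : eps * (a1 * (8 * (k * k) * L)) <= eps * n by rewrite ler_wpM2l // ltW.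
  have t3 : eps * n <= eps * (2 * k * D) by rewrite ler_wpM2l // ltW.
  have t4 : a1 * (8 * (k * 2)) <= a1 * (8 * (k * k)).
    by rewrite !ler_wpM2l //; lra.
  have t5 : 0 <= a1 * k by rewrite mulr_ge0 //; lra.
  lra.
have bl : b * ((1 - eps / 4) * L) <= b * l by rewrite ler_wpM2l.
have bl2 : (1 - eps / 4) * ((1 + eps) * D) <= (1 - eps / 4) * (b * L).
  by rewrite ler_wpM2l //; lra.
have ee : 0 <= eps * (1 - eps) * D by rewrite !mulr_ge0 //; lra.
lra.
Qed.

End RealInequalities.

Lemma divn_bounds d n : (0 < d <= n)%N ->
  [/\ (0 < n %/ d)%N, (n %/ d * d <= n)%N & (n <= 2 * d * (n %/ d))%N].
Proof.
move=> /andP [d0 dn]; have q0 : (0 < n %/ d)%N by rewrite divn_gt0.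
split=> //; first exact: leq_trunc_div.
have := ltn_ceil n d0; move: (n %/ d)%N q0 => q q0 h.
by nia.
Qed.

(** * Choice of parameters for large boards *)

Section Threshold.
Variable R : realType.
Implicit Types (n k b : nat) (eps : R).

Lemma codeg_deg n k : (1 < k <= n)%N ->
  (k%:R - 1) * 'C(n.-1, k.-1)%:R = (n%:R - 1) * 'C(n - 2, k - 2)%:R :> R.
Proof.
case: k => [//|[//|k]]; case: n => [//|[//|n]] _; rewrite !subSS !subn0 /=.
rewrite -!(natr1 k.+1) -(natr1 n.+1) !addrK -!natrM.
by rewrite -mul_bin_diag.
Qed.

Lemma deg_binomial n k : (1 < k <= n)%N ->
  n%:R * 'C(n.-1, k.-1)%:R = (n%:R - k%:R + 1) * 'C(n, k.-1)%:R :> R.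
Proof.
case: k => [//|k] /andP [_ kn] /=.
rewrite -natrM mul_bin_down natrM natrB ?(ltnW kn) // -(natr1 k).
by congr (_ * _); ring.
Qed.

(** With [q = n %/ H] as both danger threshold and number of partners, and [k0 = q %/ H2],
    everything is linear in [n]. [H] keeps [q * Q] small against [D], [H2] makes the potential
    small, and [n <= G * k0]. *)
Lemma maker_side k eps : (2 <= k)%N -> 0 < eps <= 1 ->
  exists n0 : nat, forall n b, (n0 <= n)%N ->
    b%:R <= (1 - eps) * 'C(n, k.-1)%:R / ln n%:R -> maker_wins_berge n k b.
Proof.
move=> k2 /[dup] he /andP [e0 e1].
have [H hH] : exists H : nat, 32 * k%:R <= eps * H%:R.
  exists (Num.truncn (32 * k%:R / eps)).+1.
  by rewrite [leRHS]mulrC -ler_pdivrMr //; apply/ltW/truncnS_gt.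
have H0 : (0 < H)%N.
  rewrite -(ltr_nat R) -(pmulr_rgt0 _ e0); apply: lt_le_trans hH.
  by rewrite mulr_gt0 // ltr0n ltnW.
(* Stated as an equation under [forall] to hide the large constant from [lia]. *)
have [H2 [H2P H2_ge3]] : exists h,
    (forall x, h * x = 9216 * (2 * H) ^ 4 * x)%N /\ (2 < h)%N.
  exists (9216 * (2 * H) ^ 4)%N; split=> //.
  by apply: (@leq_trans (9216 * 1)) => //; rewrite leq_mul2l expn_gt0 muln_gt0 H0.
have [G GP] : exists G, forall x, (G * x = 2 * H * (2 * H2) * x)%N by eexists.
have [n1 hn1] := ln_large (1 : R).
have [n2 hn2] := ln_large (8 * (5 * k%:R + 1 + 2 * H%:R * k%:R) / eps).
have [n3 hn3] := ln_large (6 * (k%:R * k%:R) * (G%:R * G%:R) + 1 : R).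
have c0 : 0 < eps / 4 / k%:R by rewrite !divr_gt0 // ltr0n; lia.
(* The constant 1 absorbs the passage from [n] to [n - 1] in [bias_bound]. *)
have [n4 hn4] := ln_small_linear 1 c0.
exists (n1 + n2 + n3 + n4 + H * H2 + k + 3)%N => n b hn hb.
have [n1n n2n n3n n4n] : [/\ n1 <= n, n2 <= n, n3 <= n & n4 <= n]%N by split; lia.
have [HH2n kn n_ge3] : [/\ H * H2 <= n, k <= n & 2 < n]%N by split; lia.
move: {hn hn1 hn2 hn3 hn4} (hn1 n n1n) (hn2 n n2n) (hn3 n n3n) (hn4 n n4n) => hn1 hn2 hn3 hn4.
have hnH : (0 < H <= n)%N by rewrite H0 (leq_trans _ HH2n) // leq_pmulr // ltnW // ltnW.
have [q0 qH nH] := divn_bounds hnH; set q := (n %/ H)%N in q0 qH nH.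
have hqH2 : (0 < H2 <= q)%N by rewrite /q leq_divRL // mulnC HH2n (leq_trans _ H2_ge3).
have [k00 k0H qH2] := divn_bounds hqH2; set k0 := (q %/ H2)%N in k00 k0H qH2.
have {}kn : (1 < k <= n)%N by rewrite k2.
have hL0 : 0 < ln n%:R :> R by lra.
have k2R : 2 <= k%:R :> R by rewrite ler_nat.
have Q1 : (0 < 'C(n - 2, k - 2))%N by rewrite bin_gt0 leq_sub2r; case/andP: kn.
have Q1R : 1 <= 'C(n - 2, k - 2)%:R :> R by rewrite ler1n.
have hD := codeg_deg kn; have hN := deg_binomial kn.
have qHR : q%:R * H%:R <= n%:R :> R by rewrite -natrM ler_nat.
have nHR : n%:R <= 2 * H%:R * q%:R :> R by rewrite -!natrM ler_nat.
have q1R : 1 <= q%:R :> R by rewrite ler1n.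
have b0R : 0 <= b%:R :> R by [].
have n3R : 3 <= n%:R :> R by rewrite ler_nat.
have aL : b.+1%:R * ln n%:R <= (1 - eps / 2) * 'C(n.-1, k.-1)%:R.
  rewrite -natr1; apply: (bias_bound he k2R _ Q1R _ _ b0R hD hN) => //.
  - have H1R : H%:R <= n%:R :> R by rewrite ler_nat; case/andP: hnH.
    have : eps * H%:R <= eps * n%:R by rewrite ler_wpM2l // ltW.
    lra.
  - exact: ltW.
  - have k0R : 0 < k%:R :> R by lra.
    have e4 : eps / 4 / k%:R * n%:R = eps / 4 * n%:R / k%:R by rewrite mulrAC.
    rewrite e4 ler_pdivlMr // in hn4.
    have : eps / 4 <= 1 by lra.
    lra.
  - by rewrite -ler_pdivlMr.
apply: (@maker_wins_of_bounds R n k b q q k0) => //.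
- apply: leq_trans (leq_trunc_div n H); apply: (@leq_trans q); last exact: leq_pmulr.
  by apply: leq_trans k0H; rewrite mulnC leq_mul2l H2_ge3 orbT.
- apply: (@le_trans _ _ (k%:R * b.+1%:R * 5 + (b.+1%:R * ln n%:R + q%:R * 'C(n - 2, k - 2)%:R
     + n%:R * (k%:R * b.+1%:R / q%:R)) + b.+1%:R + q%:R * 'C(n - 2, k - 2)%:R)).
    have cap := @danger_cap_le R n k b.+1 q (ltnW (ltnW n_ge3)) q0.
    rewrite !natrM in cap *; rewrite lerD2r lerD2r lerD2l; exact: cap.
  apply: (danger_bound_arith he k2R _ _ _ _ _ _ hD aL qHR nHR hH) => //; try lra.
  by rewrite [leRHS]mulrC -ler_pdivrMr.
- have nH4 : (n ^ 4 <= (2 * H) ^ 4 * q ^ 4)%N by rewrite -expnMn leq_exp2r.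
  apply: (@leq_trans (q ^ 4 * (k0 * H2))); last by rewrite [leqRHS]expnSr leq_mul2l k0H orbT.
  rewrite mulnA [leqRHS]mulnC H2P mulnA leq_mul2r -mulnA leq_mul2l.
  by rewrite nH4 !orbT.
rewrite -(ltr_nat R) !natrM.
apply: (booster_bound_arith (L := ln n%:R) (G := G%:R) k2R _ Q1R _ _ hL0 hD) => //.
- by lra.
- by rewrite ltr0n.
- have : 0 <= eps / 2 * 'C(n.-1, k.-1)%:R :> R by rewrite mulr_ge0 //; lra.
  lra.
- rewrite -natrM ler_nat GP; apply: leq_trans nH _.
  by rewrite -[leqRHS]mulnA leq_mul2l qH2 orbT.
- by lra.
Qed.

Lemma breaker_side k eps : (2 <= k)%N -> 0 < eps <= 1 ->
  exists n0 : nat, forall n b, (n0 <= n)%N -> (0 < b)%N ->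
    (1 + eps) * 'C(n, k.-1)%:R / ln n%:R <= b%:R -> breaker_wins_berge n k b.
Proof.
move=> k2 /[dup] he /andP [e0 e1].
have k2R : 2 <= k%:R :> R by rewrite ler_nat.
(* With this constant the first phase touches at most half of about [n / (H * ln n)] chosen
   vertices. *)
pose H : R := 8 * (k%:R * k%:R).
have H0 : 0 < H by rewrite !mulr_gt0 // ltr0n ltnW.
have [n1 hn1] := ln_large (1 / eps).
have [n2 hn2] := ln_large (8 / eps * (ln (4 * H) + ln (8 / eps))).
have c0 : 0 < ((4 * k%:R + 4) * H)^-1 by rewrite invr_gt0 mulr_gt0 //; lra.
have [n3 hn3] := ln_small_linear 0 c0.
exists (n1 + n2 + n3 + k + 2)%N => n b hn b0 hb.
have [n1n n2n n3n] : [/\ n1 <= n, n2 <= n & n3 <= n]%N by split; lia.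
have [kn n_ge2] : [/\ k <= n & 2 <= n]%N by split; lia.
move: {hn hn1 hn2 hn3} (hn1 n n1n) (hn2 n n2n) (hn3 n n3n).
set L := ln n%:R => hn1 hn2 hn3.
have eL : 1 <= eps * L by rewrite -ler_pdivrMl // mulrC.
have L1 : 1 <= L.
  have : 0 <= (1 - eps) * L; last by lra.
  rewrite mulr_ge0 ?subr_ge0 // -(@pmulr_rge0 _ eps) //; lra.
have L0 : 0 < L by lra.
have nR : 2 <= n%:R :> R by rewrite ler_nat.
have n0 : 0 < n%:R :> R by lra.
set x := n%:R / (H * L).
have HL0 : 0 < H * L by rewrite mulr_gt0.
have x_ge : 4 * k%:R + 4 <= x.
  rewrite /x ler_pdivlMr // mulrA -ler_pdivlMl; last by rewrite mulr_gt0 //; lra.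
  by rewrite add0r in hn3.
have x0 : 0 <= x by lra.
pose a0 := Num.truncn x; pose a1 := (a0 %/ 2)%N.
have /andP [a0x xa0] := truncn_itv x0; rewrite -/a0 -natr1 in a0x xa0.
have a1a0 : (2 * a1 <= a0)%N by rewrite mulnC leq_trunc_div.
have a0a1 : (a0 <= 2 * a1 + 1)%N by rewrite {1}(divn_eq a0 2) mulnC leq_add2l -ltnS ltn_mod.
have a1a0R : 2 * a1%:R <= a0%:R :> R by rewrite -natrM ler_nat.
have a0a1R : a0%:R <= 2 * a1%:R + 1 :> R by rewrite -natrM natr1 ler_nat -addn1.
have a0k : 4 * k%:R <= a0%:R :> R by lra.
have a0n : a0%:R * (H * L) <= n%:R by rewrite -ler_pdivlMr.
have a1_gt0 : (0 < a1)%N by rewrite -(ltr_nat R); lra.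
have a1n : a1%:R * (H * L) <= n%:R.
  by apply: le_trans a0n; rewrite ler_wpM2r ?(ltW HL0) //; lra.
have {}kn : (1 < k <= n)%N by rewrite k2.
have Q1 : (0 < 'C(n - 2, k - 2))%N by rewrite bin_gt0 leq_sub2r //; case/andP: kn.
have Q1R : 1 <= 'C(n - 2, k - 2)%:R :> R by rewrite ler1n.
have hD := codeg_deg kn.
have DN : 'C(n.-1, k.-1)%:R <= 'C(n, k.-1)%:R :> R by rewrite ler_nat leq_bin2l // leq_pred.
have bD : (1 + eps) * 'C(n.-1, k.-1)%:R <= b%:R * L.
  rewrite ler_pdivrMr // in hb; apply: le_trans hb; rewrite ler_wpM2l //; lra.
have Dle : 'C(n.-1, k.-1)%:R <= b%:R * L.
  apply: le_trans bD; rewrite mulrDl mul1r lerDl mulr_ge0 //; exact: ltW.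
apply: (@breaker_wins_of_bounds n k b a0 a1) => //.
- rewrite -(ler_nat R); apply: le_trans a0n; rewrite ler_peMr //.
  have kk : 1 * 1 <= k%:R * k%:R :> R by rewrite ler_pM //; lra.
  have : 1 * 1 <= H * L by rewrite ler_pM // /H; lra.
  by rewrite mulr1.
- rewrite -(ler_nat R) natrD natrM -natr1.
  apply: (clearing_bound_arith k2R nR _ L0 _ _ hD Dle _ a0n a0k a1a0R) => //.
    by lra.
  by rewrite -!natrM ler_nat leq_trunc_div.
rewrite -(ler_nat R); apply: le_trans (sum_div_ge R b a1_gt0).
apply: (box_bound_arith he k2R nR Q1R _ hD bD a1n _ eL) => //.
have x4 : 0 < x / 4 by lra.
have a1R : 0 < a1%:R :> R by rewrite ltr0n.
(* Compared with [L], [ln a1] loses at most [ln (4 * H) + ln L]. The bound on [ln L] costs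
   [eps / 8 * L], and the remaining constants another [eps / 8 * L]. *)
apply: (@le_trans _ _ (ln (x / 4))); last by rewrite ler_ln ?posrE //; lra.
have -> : x / 4 = n%:R / (4 * H * L) by rewrite /x; field; rewrite !gt_eqF.
have H4 : 0 < 4 * H by rewrite mulr_gt0.
have H4L : 0 < 4 * H * L by rewrite mulr_gt0.
rewrite ln_div ?posrE // -/L lnM ?posrE //.
have e8 : 0 < 8 / eps by rewrite divr_gt0.
have hL := ln_le_div L0 e8.
have e' : L / (8 / eps) = L * eps / 8 by rewrite invf_div mulrA.
rewrite e' in hL.
have : eps / 8 * (8 / eps * (ln (4 * H) + ln (8 / eps))) <= eps / 8 * L.
  by rewrite ler_wpM2l // divr_ge0 // ltW.
have -> : eps / 8 * (8 / eps * (ln (4 * H) + ln (8 / eps))) = ln (4 * H) + ln (8 / eps).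
  by field; rewrite gt_eqF.
lra.
Qed.

End Threshold.

Theorem theorem3 (R : realType) (k : nat) (hk : (2 <= k)%N)
    (eps : R) (heps : 0 < eps) :
  exists n0 : nat, forall n : nat, (n0 <= n)%N ->
    forall (b : nat) (beta : R), (0 < b)%N ->
      b%:R = beta * ('C(n, k.-1))%:R / ln n%:R ->
      (beta <= 1 - eps -> maker_wins_berge n k b) /\
      (1 + eps <= beta -> breaker_wins_berge n k b).
Proof.
(* Shrinking [eps] only weakens the two hypotheses on [beta], so [eps <= 1] may be assumed. *)
set d := Num.min eps 1.
have hd : 0 < d <= 1 by rewrite /d lt_min heps ltr01 ge_min lexx orbT.
have deps : d <= eps by rewrite /d ge_min lexx.
have [n1 maker] := maker_side hk hd.
have [n2 breaker] := breaker_side hk hd.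
exists (maxn (maxn n1 n2) 2) => n; rewrite !geq_max => /andP [/andP [n1n n2n] n_ge2].
move=> b beta b0 def_b.
have L0 : 0 <= (ln n%:R)^-1 :> R by rewrite invr_ge0 ln_ge0 // ler1n ltnW.
split=> hbeta.
  by apply: maker => //; rewrite def_b !ler_wpM2r //; lra.
by apply: breaker => //; rewrite def_b !ler_wpM2r //; lra.
Qed.
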